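(* Let $\beta>0$, $c_f>0$, $c_a>0$, and let $N$ dynamic items have sizes $b_n>0$, popularities $p_n>0$ with $\sum_{n=1}^N p_n=1$, and refresh rates $\lambda_n>0$ ($n=1,\dots,N$). Requests arrive at a local cache according to a Poisson process of rate $\beta$, each request being independently for item $n$ with probability $p_n$; the cache knows $\beta$, $\mathbf p=(p_n)$, $\boldsymbol\lambda=(\lambda_n)$. Let $\tilde B\ge 0$ and suppose the cache is subject to the constraint that its average cache occupancy be at most $\tilde B$. Then there exists $\tilde\alpha^*\ge 0$ such that, with $$\tau_n^*=\tau_n^*(\beta,\mathbf p,\boldsymbol\lambda)=\frac{1}{\beta p_n}\left[\sqrt{1+2\,b_n\,\frac{\beta p_n c_f-\tilde\alpha^*}{c_a\lambda_n}}-1\right]^+,\qquad n=1,\dots,N,$$ one has $$\sum_{n=1}^N\frac{\beta p_n\tau_n^*}{\beta p_n\tau_n^*+1}\,b_n\le\tilde B\qquad\text{and}\qquad \tilde\alpha^*\left(\sum_{n=1}^N\frac{\beta p_n\tau_n^*}{\beta p_n\tau_n^*+1}\,b_n-\tilde B\right)=0,$$ and for such $\tilde\alpha^*$ the eviction-based (timer) policy with constant timers $\tau_1^*,\dots,\tau_N^*$ is optimal: it minimizes the long-term average cost among all admissible caching policies whose average cache occupancy is at most $\tilde B$.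
   Context: Model. Requests for item $n$ form a Poisson process of rate $\beta p_n$, independent across items. Item $n$ is updated in a back-end database at average rate $\lambda_n$. The age $\Delta_n(t)$ of the cached copy of item $n$ is the number of updates of the item since it was last fetched into the cache; the cache does not observe updates. Fetching item $n$ from the back-end costs $b_nc_f$; serving a request for item $n$ from the cache costs $c_a\Delta_n(t)$, which, when the time elapsed since the last fetch is $s_n(t)$, is accounted for by its expected value $c_a\lambda_n s_n(t)$. A request served by a fetch incurs only the fetching cost. Admissible policy. A causal (non-anticipating) rule which, based on the history of requests and of its own actions, decides at each time $t\ge0$ and for each item $n$ whether to fetch the item from the back-end ($u_n(t)=1$) or not ($u_n(t)=0$), and how long to keep a stored copy before evicting it. A request for an item that is stored may be served from the cache ($u_n(t)=0$) or by a fetch ($u_n(t)=1$); a request for an item that is not stored must be served by a fetch. The cache is initially empty. Long-term average cost. $\limsup_{T\to\infty}\frac1T\,\mathbb E[\text{total fetching cost plus freshness (aging) cost over all items incurred in }[0,T]]$. Average cache occupancy. $\limsup_{T\to\infty}\frac1T\,\mathbb E\left[\int_0^T\sum_{n=1}^N b_n\mathbf 1\{\text{item } n \text{ is stored at time } t\}\,dt\right]$. Eviction-based (timer) policy with timers $\tau_1,\dots,\tau_N\ge0$. Fetches occur only at request arrivals. When item $n$ is requested and is not in the cache, it is fetched, served and stored, and a timer of constant length $\tau_n$ is started at the moment of storage; requests arriving before the timer expires are served from the cache and do not reset the timer; when the timer expires the item is evicted. Notation. $[x]^+=\max(x,0)$; if the quantity under the square root is negative, the bracket $[\cdot]^+$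 is taken to be $0$. *)

(* Defs.v *)
From HB Require Import structures.
From mathcomp Require Import all_boot all_order all_algebra.
From mathcomp Require Import all_classical all_reals all_analysis.
From mathcomp Require Import measurable_realfun.

Set Implicit Arguments.
Unset Strict Implicit.
Unset Printing Implicit Defensive.

Import Order.TTheory GRing.Theory Num.Theory.
Import numFieldNormedType.Exports.

Local Open Scope classical_set_scope.
Local Open Scope ring_scope.

(* A finite request history: the (arrival time, item) pairs, oldest first. *)
Definition history (R : realType) (N : nat) := seq (R * 'I_N).

Definition possible_history (R : realType) (N : nat) (h : history R N) : bool :=
  path <%R 0 (unzip1 h).

Definition upto (R : realType) (N : nat) (h : history R N) (t : R) :
    history R N :=
  [seq r <- h | r.1 <= t].

(* A rule decides at each time t, for each item, whether to fetch it and
   whether to evict (not keep) its copy, as a function of the requests that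
   arrived in [0, t]. Causality is built into the type; the past actions of the
   rule are themselves functions of the request history, so they need not be a
   separate argument. The keeping time of a copy may thus depend on anything
   observed before the eviction. *)
Record policy (R : realType) (N : nat) := Policy {
  fetch : history R N -> R -> 'I_N -> bool ;
  evict : history R N -> R -> 'I_N -> bool }.

Section Dynamics.
Context (R : realType) (N : nat).
Implicit Types (pi : policy R N) (h : history R N) (t T : R) (n : 'I_N).

(* Below, h is a history that covers [0, t] at least; the entries later than t
   are never read. *)

(* u_n(t) = 1 *)
Definition fetch_at pi h t n : bool := (0 <= t) && fetch pi (upto h t) t n.

Definition evict_at pi h t n : bool := evict pi (upto h t) t n.

(* The state found by a request arriving at t: a decision made at time s takes
   effect immediately after s, so a copy fetched at f and first evicted at e is
   stored during ]f, e]. If e = f, the item is served without being stored.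
   In particular the state at t does not depend on a request arriving at t. *)
Definition stored pi h t n : bool :=
  `[< exists f, [/\ f < t, fetch_at pi h f n
        & forall s, f <= s < t -> ~~ evict_at pi h s n] >].

(* s_n(t), the time elapsed since the last fetch before t *)
Definition elapsed pi h t n : R :=
  t - sup [set f | f < t /\ fetch_at pi h f n].

(* The number (possibly +oo) of fetches of item n in [0, T]. *)
Definition nfetch pi h T n : \bar R :=
  \esum_(f in [set f | f <= T /\ fetch_at pi h f n]) 1%E.

(* Here h is exactly the history on [0, T]. *)
Definition total_cost (cf ca : R) (b lam : 'I_N -> R) pi T h : \bar R :=
  (\sum_(n < N) (b n * cf)%:E * nfetch pi h T n
   + (\sum_(r <- h) (if fetch_at pi h r.1 r.2 then 0
                     else ca * lam r.2 * elapsed pi h r.1 r.2))%:E)%E.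

Definition total_occupancy (b : 'I_N -> R) pi T h : \bar R :=
  (\int[lebesgue_measure]_(t in `[0%R, T])
     (\sum_(n < N) b n * (stored pi h t n)%:R)%:E)%E.

(* Regularity that makes the expectations below meaningful. For a fixed number k
   of requests, for items m, the arrival times range over k.-tuple R. *)
Definition measurable_policy pi : Prop :=
  forall (k : nat) (m : k.-tuple 'I_N) (n : 'I_N),
    let D := [set a : k.-tuple R | possible_history (zip a m)] in
    [/\ measurable_fun (D `*` setT)
          (fun z : k.-tuple R * R => fetch_at pi (zip z.1 m) z.2 n),
        measurable_fun (D `*` setT)
          (fun z : k.-tuple R * R => stored pi (zip z.1 m) z.2 n),
        measurable_fun (D `*` setT)
          (fun z : k.-tuple R * R => elapsed pi (zip z.1 m) z.2 n) &
        forall T, measurable_fun D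
          (fun a : k.-tuple R => nfetch pi (zip a m) T n)].

Definition admissible pi : Prop :=
  measurable_policy pi /\
  forall h t n, possible_history h -> (t, n) \in h ->
    ~~ stored pi h t n -> fetch_at pi h t n.

(* The time of the last fetch of item n under the timer rule: a request for n
   triggers a fetch unless it arrives within tau n of the previous fetch. *)
Definition timer_last_fetch (tau : 'I_N -> R) h n : option R :=
  foldl (fun last r =>
    if r.2 != n then last
    else if last is Some f then if r.1 <= f + tau n then last else Some r.1
    else Some r.1) None h.

Definition timer_policy (tau : 'I_N -> R) : policy R N := {|
  fetch := fun h t n => timer_last_fetch tau h n == Some t ;
  evict := fun h t n =>
    if timer_last_fetch tau h n is Some f then f + tau n <= t else false |}.

End Dynamics.

Section Requests.
Context (R : realType) (N : nat) (d : measure_display) (Omega : measurableType d)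
  (P : probability Omega R).
Implicit Types (X : nat -> {RV P >-> R}) (Y : nat -> Omega -> 'I_N).

(* A Poisson process of rate beta with i.i.d. marks of law p: the interarrival
   times X k are exponential(beta), the requested items Y k have law p, and all
   of these variables are mutually independent. *)
Definition poisson_requests (beta : R) (p : 'I_N -> R) X Y : Prop :=
  [/\ forall k (U : set R), measurable U ->
        distribution P (X k) U = exponential_prob beta U,
      forall k n, measurable (Y k @^-1` [set n]) /\
        P (Y k @^-1` [set n]) = (p n)%:E &
      forall (K : nat) (U : nat -> set R) (V : nat -> set 'I_N),
        (forall k, measurable (U k)) ->
        P (\bigcap_(k in `I_K) (X k @^-1` U k `&` Y k @^-1` V k)) =
        (\prod_(k < K) (P (X k @^-1` U k) * P (Y k @^-1` V k)))%E].

Definition arrival X (k : nat) (w : Omega) : R := \sum_(i < k.+1) X i w.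

(* The number of arrivals in [0, T]. Almost surely, the interarrival times are
   positive with infinite sum, and it is the unique k below; the default 0 is
   only used on the remaining null set. *)
Definition nb_requests X (T : R) (w : Omega) : nat :=
  xget 0%N [set k | (forall i, 0 < X i w) /\
                    forall i, (arrival X i w <= T) = (i < k)%N].

Definition requests X Y (T : R) (w : Omega) : history R N :=
  [seq (arrival X k w, Y k w) | k <- iota 0 (nb_requests X T w)].

Definition long_term_average (f : R -> \bar R) : \bar R :=
  limf_esup (fun T : R => (T^-1)%:E * f T)%E (pinfty_nbhs R).

Definition average_cost X Y (cf ca : R) (b lam : 'I_N -> R) (pi : policy R N) :
    \bar R :=
  long_term_average (fun T =>
    \int[P]_w total_cost cf ca b lam pi T (requests X Y T w))%E.

Definition average_occupancy X Y (b : 'I_N -> R) (pi : policy R N) : \bar R :=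
  long_term_average (fun T =>
    \int[P]_w total_occupancy b pi T (requests X Y T w))%E.

Definition optimal X Y (cf ca : R) (b lam : 'I_N -> R) (B : R)
    (pi : policy R N) : Prop :=
  [/\ admissible pi,
      (average_occupancy X Y b pi <= B%:E)%E &
      forall pi', admissible pi' ->
        (average_occupancy X Y b pi' <= B%:E)%E ->
        (average_cost X Y cf ca b lam pi
           <= average_cost X Y cf ca b lam pi')%E].

End Requests.

Section Timers.
Context (R : realType) (N : nat).

(* Num.sqrt of a negative number is 0, which makes the bracket 0 as well. *)
Definition tau_star (beta cf ca : R) (b p lam : 'I_N -> R) (alpha : R)
    (n : 'I_N) : R :=
  (beta * p n)^-1 *
  Num.max (Num.sqrt (1 + 2 * b n * ((beta * p n * cf - alpha) / (ca * lam n)))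
           - 1) 0.

Definition timer_occupancy (beta : R) (b p tau : 'I_N -> R) : R :=
  \sum_(n < N) beta * p n * tau n / (beta * p n * tau n + 1) * b n.

Definition complementary_slackness (beta cf ca : R) (b p lam : 'I_N -> R)
    (B alpha : R) : Prop :=
  let S := timer_occupancy beta b p (tau_star beta cf ca b p lam alpha) in
  S <= B /\ alpha * (S - B) = 0.

End Timers.

(* Main.v *)
Require Import Defs.
From HB Require Import structures.
From mathcomp Require Import all_boot all_order all_algebra.
From mathcomp Require Import all_classical all_reals all_analysis.
From mathcomp Require Import measurable_realfun.
From mathcomp Require Import ring lra.

Set Implicit Arguments.
Unset Strict Implicit.
Unset Printing Implicit Defensive.

Import Order.TTheory GRing.Theory Num.Theory.
Import numFieldNormedType.Exports.

Local Open Scope classical_set_scope.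
Local Open Scope ring_scope.

(** Fix an item, requested at rate [r], whose copy ages at rate [a], whose fetch
    costs [c] and whose timer is [tau]; put [gain = c - r * a * tau ^ 2 / 2].

    A multiplier [alpha] for the occupancy constraint decouples the items: it
    is enough to bound, for each of them, its cost plus [alpha * b] times its
    storage, where [b] is its size. The bound is [r * gain] per unit of time, and
    it comes from a price attached to every instant [t], the price of serving a
    request at [t]: it is [gain] if no copy is stored, and [a] times the age of
    the copy, capped at [tau], otherwise. On every path,
    - the prices of the requests add up to at most [gain] per fetch, plus the
      aging costs;
    - at every instant, [r * gain] is at most [alpha * b] while a copy is stored,
      plus [r] times the price, plus [r * a * (tau - s)] while the last fetch
      is at a distance [s <= tau]; this last term integrates to at most
      [r * a * tau ^ 2 / 2] per fetch, which is [c - gain].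
    The two points rest on [a * tau <= gain] and [r * gain <= alpha * b + r * a * tau],
    which hold for the timers [tau_star] ([tau_star_gain_ge], [tau_star_gain_le]).
    Added together ([item_cost_lower_bound]), they bound the cost plus priced
    storage from below by [T * r * gain], plus the prices of the requests, minus
    [r] times the integral of the price. The price at [t] depends only on the
    requests before [t], so that the last two terms have the same expectation
    ([expected_sum_over_requests]) and cancel ([expected_cost_lower_bound]).

    The same formula computes the performance of the timer policy. If [F] and [O]
    are the expected number of fetches and the expected storage in [0, T], then
    [F + r * O = r * T], because the requests that find no copy are those that
    are fetched; moreover [tau * F - tau <= O <= tau * F], because only the last
    storage period may be cut at [T], and the expected aging cost is at most
    [r * a * tau ^ 2 / 2 * F]. As [T] grows, the occupancy is thus at most
    [r * tau / (1 + r * tau)] and the cost rate at most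
    [(c + r * a * tau ^ 2 / 2) * r / (1 + r * tau)]. For the timers
    [tau_star], this cost plus [alpha * b] times this occupancy is exactly
    [r * gain] ([tau_star_balance]). Summed over the items, complementary
    slackness replaces [alpha] times the total occupancy by [alpha * B], which is
    at least what any competitor is charged.

    The formula for sums over requests is proved one interarrival time at a
    time: given the earlier requests, the next gap is an exponential variable [X]
    independent of them, and [E f(X) = rate * E (\int_0^X f)]
    ([exponential_compensator]). Finally, [alpha] exists by the intermediate value
    theorem ([exists_complementary_slackness]). *)

(** * Variables independent of the past *)

Section IndependentPast.
Local Open Scope ereal_scope.
Context (R : realType) d (T : measurableType d) (P : probability T R).
Context d2 (T2 : measurableType d2) (mu : probability T2 R).
Variables (G : set (set T)) (A : set T) (W : T -> T2) (c : {nonneg R}).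
Hypotheses (Gm : G `<=` measurable) (GT : G setT) (GI : setI_closed G).
Hypotheses (mA : measurable A) (mW : measurable_fun setT W).
Hypothesis indep : forall E U, G E -> measurable U ->
  P (E `&` A `&` W @^-1` U) = c%:num%:E * P E * mu U.

Let past := g_sigma_algebraType G.

Lemma past_measurable (E : set past) : measurable E -> d.-measurable (E : set T).
Proof.
by move=> mE; apply: (smallest_sub _ Gm) mE; exact: sigma_algebra_measurable.
Qed.

Lemma measurable_past d' (T' : measurableType d') (f : T -> T') :
  measurable_fun setT (f : past -> T') -> measurable_fun setT f.
Proof.
move=> mf _ U mU; rewrite setTI; apply: past_measurable.
by rewrite -[X in measurable X]setTI; exact: mf.
Qed.

Lemma measurable_id_past : measurable_fun setT (id : T -> past).
Proof. by move=> _ U mU; rewrite setTI; exact: past_measurable. Qed.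

Let mpair : measurable_fun setT (fun w : T => ((w : past), W w)).
Proof. by apply: measurable_fun_pair => //; exact: measurable_id_past. Qed.

(** Independence on the pi-system G extends to the sigma-algebra it generates. *)
Lemma past_indepE (E : set past) (U : set T2) : measurable E -> measurable U ->
  P (E `&` A `&` W @^-1` U) = c%:num%:E * P E * mu U.
Proof.
move=> mE mU.
have mWU : measurable (W @^-1` U) by rewrite -[X in measurable X]setTI; exact: mW.
have mAW : measurable (A `&` W @^-1` U) by exact: measurableI.
pose k : {nonneg R} := NngNum (fine_ge0 (measure_ge0 mu U)).
have kE : k%:num%:E = mu U by rewrite /= fineK// fin_num_measure.
pose m1 := mrestr P mAW.
pose m2 := mscale k (mscale c P).
have main : forall E, <<s G >> E -> m1 E = m2 E.
  apply: (g_sigma_algebra_measure_unique G Gm (fun=> setT)) => //.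
  - by rewrite bigcup_const.
  - move=> F GF; transitivity (P (F `&` A `&` W @^-1` U)).
      by rewrite -setIA.
    by rewrite indep// -kE muleC.
  - move=> n; apply: le_lt_trans (ltry 1).
    by apply: probability_le1; exact: measurableI.
by rewrite -setIA muleC -kE; exact: (main _ mE).
Qed.

Let pastP : set past -> \bar R := pushforward P (id : T -> past).

Let pastP0 : pastP set0 = 0. Proof. exact: (measure0 P). Qed.

Let pastP_ge0 E : 0 <= pastP E. Proof. exact: (measure_ge0 P). Qed.

Let pastP_sigma_additive : semi_sigma_additive pastP.
Proof.
move=> F mF tF mUF; apply: (@measure_semi_sigma_additive _ _ _ P) => //.
- by move=> n; exact: (past_measurable (mF n)).
- exact: (past_measurable mUF).
Qed.

HB.instance Definition _ := isMeasure.Build _ _ _ pastP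
  pastP0 pastP_ge0 pastP_sigma_additive.

HB.instance Definition _ := Measure_isProbability.Build _ _ _ pastP
  (probability_setT P).

(** Fubini's theorem for a variable W independent of a sigma-algebra: the past is
    a copy of T that carries the smaller sigma-algebra, and the law of
    [(w, W w)] on its product with T2 is then a product measure. The event A, of
    probability c, is independent of both; below it fixes the item of a
    request. *)
Lemma integral_indep_past (f : past * T2 -> \bar R) :
  measurable_fun setT f -> (forall z, 0 <= f z) ->
  \int[P]_(w in A) f (w, W w) = c%:num%:E * \int[P]_w \int[mu]_x f (w, x).
Proof.
move=> mf f0.
pose h : T -> past * T2 := fun w => ((w : past), W w).
pose q := mrestr P mA.
pose m'_ : {measure set (past * T2) -> \bar R} := pushforward q h.
pose m' := m'_ mpair.
have prodE S : measurable S -> (mscale c pastP \x mu) S = m' S.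
  apply: product_measure_unique => E U mE mU.
  rewrite /= /mscale -past_indepE// -setIA [A `&` _]setIC setIA.
  by [].
transitivity (\int[m']_z f z).
  rewrite [RHS]ge0_integral_pushforward// preimage_setT.
  rewrite (ge0_negligible_integral (N := ~` A))//.
  - rewrite setTD setCK; apply: eq_measure_integral => B mB BA.
    by rewrite /= /q /mrestr setIidl.
  - exact: measurableC.
  - exact: measurableT_comp mf mpair.
  - by move=> w _; exact: f0.
  - by rewrite /= /q /mrestr setICl measure0.
transitivity (\int[mscale c pastP \x mu]_z f z).
  by apply: eq_measure_integral => S mS _; symmetry; exact: prodE.
rewrite fubini_tonelli1// ge0_integral_mscale//.
- rewrite /fubini_F; congr (_ * _).
  rewrite [LHS]ge0_integral_pushforward//.
  + exact: measurable_id_past.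
  + exact: measurable_fun_fubini_tonelli_F.
  + by move=> w _; exact: integral_ge0.
- exact: measurable_fun_fubini_tonelli_F.
- by move=> w _; exact: integral_ge0.
Qed.
End IndependentPast.

(** * Exponential waiting times *)

Section Density.
Local Open Scope ereal_scope.
Context d (T : measurableType d) (R : realType).
Variables (mu nu : {measure set T -> \bar R}) (g : T -> R).
Hypotheses (mg : measurable_fun setT g) (g0 : forall x, (0 <= g x)%R).
Hypothesis nuE : forall A, measurable A -> nu A = \int[mu]_(x in A) (g x)%:E.

Import HBNNSimple.

Let nnsfun_density (h : {nnsfun T >-> R}) :
  \int[nu]_x (h x)%:E = \int[mu]_x ((h x)%:E * (g x)%:E).
Proof.
under [LHS]eq_integral do rewrite fimfunE -fsumEFin//.
rewrite [LHS]ge0_integral_fsum//; last 2 first.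
  - by move=> r; exact/measurable_EFinP/measurableT_comp.
  - by move=> n x _; rewrite EFinM nnfun_muleindic_ge0.
under [RHS]eq_integral.
  move=> x xD; rewrite fimfunE -fsumEFin// ge0_mule_fsuml; last first.
    by move=> r; rewrite EFinM nnfun_muleindic_ge0.
  over.
have mgi r : measurable_fun setT
    (fun x => (r * \1_(h @^-1` [set r]) x)%:E * (g x)%:E).
  by apply: emeasurable_funM => //; exact/measurable_EFinP/measurableT_comp.
rewrite [RHS]ge0_integral_fsum//; last first.
  by move=> r x _; apply: mule_ge0; [rewrite EFinM nnfun_muleindic_ge0|rewrite lee_fin].
apply: eq_fsbigr => r _; rewrite integralZl_indic_nnsfun//.
have [r0|r0] := leP 0%R r; last first.
  rewrite preimage_nnfun0// indic0 integral0_eq; last by [].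
  by rewrite mule0 integral0_eq// => x _; rewrite mulr0 mul0e.
rewrite integral_indic// setIT nuE//.
under [RHS]eq_integral do rewrite EFinM -muleA.
rewrite ge0_integralZl//.
- congr (_ * _); rewrite [LHS]integral_mkcond; apply: eq_integral => x _.
  by rewrite patchE indicE; case: ifP => _; rewrite ?mul1e ?mul0e.
- by apply: emeasurable_funM => //; exact/measurable_EFinP.
- by move=> x _; rewrite mule_ge0 ?lee_fin.
Qed.

(** The finite linear combinations of indicators satisfy this by definition of
    a density; monotone convergence does the rest. *)
Lemma ge0_integral_density (f : T -> \bar R) :
  measurable_fun setT f -> (forall x, 0 <= f x) ->
  \int[nu]_x f x = \int[mu]_x (f x * (g x)%:E).
Proof.
move=> mf f0; pose f_ := nnsfun_approx measurableT mf.
transitivity (limn (fun n => \int[nu]_x (f_ n x)%:E)).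
  rewrite -monotone_convergence//=.
  - apply: eq_integral => x /[!inE] xD; apply/esym/cvg_lim => //=.
    exact: cvg_nnsfun_approx.
  - by move=> n; apply: measurableT_comp => //; exact: measurable_funTS.
  - by move=> n x _; rewrite lee_fin.
  - by move=> x _ a b ab; rewrite lee_fin//; exact/lefP/nd_nnsfun_approx.
under eq_fun do rewrite nnsfun_density.
rewrite -monotone_convergence//=.
- apply: eq_integral => x /[!inE] xD; apply/cvg_lim => //.
  apply: cvgeZr; first by [].
  exact: cvg_nnsfun_approx.
- move=> n; apply: emeasurable_funM; first exact/measurable_EFinP/measurable_funTS.
  exact/measurable_EFinP.
- by move=> n x _; rewrite mule_ge0// lee_fin.
- move=> x _ a b ab; rewrite lee_wpmul2r ?lee_fin//.
  exact/lefP/nd_nnsfun_approx.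
Qed.
End Density.

Section Exponential.
Local Open Scope ereal_scope.
Context (R : realType) (rate : R) (rate_gt0 : (0 < rate)%R).
Variable mu : probability (measurableTypeR R) R.
Hypothesis muE : forall U, measurable U -> mu U = exponential_prob rate U.
Local Notation leb := (@lebesgue_measure R).
Local Notation pdf := (exponential_pdf rate).

Lemma exponential_tail (t : R) : (0 <= t)%R ->
  mu `[t, +oo[%classic = (expR (- rate * t))%:E.
Proof.
move=> t0; rewrite muE// /exponential_prob.
have cexp : continuous (fun z : R^o => expR (- rate * z)).
  move=> z; apply: continuous_comp; last exact: continuous_expR.
  by apply: continuousM => //; apply: (@continuousN _ R^o); exact: cst_continuous.
rewrite (@ge0_continuous_FTC2y _ _ (fun x => - (expR (- rate * x)))%R _ 0)//.
- by rewrite EFinN oppeK add0e.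
- by move=> x _; apply: exponential_pdf_ge0; exact: ltW.
- apply: (@continuous_subspaceW R^o _ _ [set` `[0%R, +oo[%R]).
    by apply: subset_itvr; rewrite bnd_simp.
  exact: within_continuous_exponential_pdf.
- rewrite -oppr0; apply: cvgN.
  rewrite (_ : (fun x => expR (- rate * x)) =
               (fun z => expR (- z)) \o (fun z => rate * z)%R); last first.
    by apply: eq_fun => x; rewrite mulNr.
  apply: (@cvg_comp _ _ _ _ _ _ (pinfty_nbhs R)); last exact: cvgr_expR.
  exact: gt0_cvgMry.
- by apply: cvgN; apply/cvg_at_right_filter; exact: cexp.
- move=> x; rewrite in_itv/= andbT => tx; apply: derive1_exponential_pdf.
  by rewrite in_itv/= andbT; exact: le_lt_trans tx.
Qed.

Lemma exponential_neg : mu `]-oo, 0%R]%classic = 0.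
Proof.
rewrite muE// /exponential_prob.
rewrite -integral_itv_bndo_bndc; last first.
  by apply/measurable_EFinP/measurable_funTS; exact: measurable_exponential_pdf.
apply: integral0_eq => x; rewrite /= in_itv/= => x0.
by rewrite lt0_exponential_pdf.
Qed.

(** The tail [mu `[t, +oo[] = expR (- rate * t)] is the density divided by the
    rate, so that this is Tonelli's theorem on the set of pairs [0 <= t <= x].
    In words: a payment made at the arrival is worth as much as the same payment
    made continuously, at the rate of the arrivals, while waiting. *)
Lemma exponential_compensator (f : R -> \bar R) :
  measurable_fun setT f -> (forall x, 0 <= f x) ->
  \int[mu]_x f x = rate%:E * \int[mu]_x \int[leb]_(t in `[0%R, x]) f t.
Proof.
move=> mf f0.
pose h (z : R * R) : \bar R := if (0 <= z.2 <= z.1)%R then f z.2 else 0.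
have mh : measurable_fun setT h.
  apply: measurable_fun_ifT => //=.
  - apply: measurable_and.
    + exact: measurable_fun_ler.
    + exact: measurable_fun_ler.
  - exact: measurableT_comp.
have h0 z : 0 <= h z by rewrite /h; case: ifP.
rewrite (ge0_integral_density (mu := leb) (g := pdf))//; last 2 first.
- exact: measurable_exponential_pdf.
- by move=> x; rewrite exponential_pdf_ge0// ltW.
have -> : \int[mu]_x \int[leb]_(t in `[0%R, x]) f t =
          \int[mu]_x \int[leb]_t h (x, t).
  apply: eq_integral => x _; rewrite integral_mkcond; apply: eq_integral => t _.
  by rewrite patchE /h/= mem_setE in_itv.
rewrite (@fubini_tonelli _ _ _ _ _ mu leb h)// -ge0_integralZl//; last 3 first.
- exact: measurable_fun_fubini_tonelli_G.
- by move=> t _; exact: integral_ge0.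
- by rewrite lee_fin ltW.
apply: eq_integral => t _.
have [t0|t0] := leP 0%R t; last first.
  rewrite lt0_exponential_pdf// mule0 integral0_eq ?mule0// => x _.
  by rewrite /h/= leNgt t0.
transitivity (rate%:E * \int[mu]_(x in `[t, +oo[) f t).
  rewrite integral_cst// exponential_pdfE// EFinM muleCA; congr (_ * (_ * _)).
  by symmetry; exact: exponential_tail.
congr (_ * _); rewrite integral_mkcond; apply: eq_integral => x _.
by rewrite patchE /h/= mem_setE in_itv/= t0 andbT.
Qed.
End Exponential.

(** The exponential measure as a bundled probability, the form in which the laws
    of the gaps enter product measures. *)
Definition exponential_law (R : realType) (rate : R) (rate_gt0 : 0 < rate) :
  probability (measurableTypeR R) R.
Proof.
pose m : probability (measurableTypeR R) R := exponential_prob rate.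
exact: (m rate_gt0).
Defined.

Lemma exponential_lawE (R : realType) (rate : R) (rate_gt0 : 0 < rate)
    (U : set (measurableTypeR R)) : measurable U ->
  exponential_law rate_gt0 U = exponential_prob rate U.
Proof. by []. Qed.

(** * Functionals of request histories *)

Lemma measurable_all_seq d (T : measurableType d) (D : set T) (I : eqType)
    (s : seq I) (b : I -> T -> bool) :
  (forall i, i \in s -> measurable_fun D (b i)) ->
  measurable_fun D (fun z => all (b^~ z) s).
Proof.
elim: s => [|i s IHs] mb /=; first exact: measurable_cst.
apply: measurable_and; first by apply: mb; rewrite mem_head.
by apply: IHs => j js; apply: mb; rewrite inE js orbT.
Qed.

Lemma measurable_fun_on d d' (T : measurableType d) (T' : measurableType d')
    (D : set T) (f g : T -> T') :
  measurable_fun D g -> (forall z, D z -> f z = g z) -> measurable_fun D f.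
Proof. by move=> mg fg; apply: eq_measurable_fun mg => z /set_mem /fg. Qed.

Lemma measurable_has_seq d (T : measurableType d) (D : set T) (I : eqType)
    (s : seq I) (b : I -> T -> bool) :
  (forall i, i \in s -> measurable_fun D (b i)) ->
  measurable_fun D (fun z => has (b^~ z) s).
Proof.
elim: s => [|i s IHs] mb /=; first exact: measurable_cst.
apply: measurable_or; first by apply: mb; rewrite mem_head.
by apply: IHs => j js; apply: mb; rewrite inE js orbT.
Qed.

Section HistoryMeasurability.
Context (R : realType) (N : nat).
Implicit Types (h : history R N).

Definition possible_times k (m : k.-tuple 'I_N) : set (k.-tuple R) :=
  [set a | possible_history (zip a m)].

Lemma possible_timesE k (m : k.-tuple 'I_N) :
  possible_times m = [set a : k.-tuple R | path <%R 0 a].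
Proof.
by apply/seteqP; split=> a; rewrite /possible_times /possible_history /=
  /unzip1 -/(unzip1 _) unzip1_zip// !size_tuple.
Qed.

Lemma measurable_nth_tuple k (i : nat) :
  measurable_fun setT (fun a : k.-tuple R => nth 0 a i).
Proof.
have [ik|ki] := ltnP i k.
  rewrite (_ : (fun _ => _) = (fun a : k.-tuple R => tnth a (Ordinal ik))).
    exact: measurable_tnth.
  by apply/funext => a; rewrite (tnth_nth 0).
rewrite (_ : (fun _ => _) = cst 0)//.
by apply/funext => a; rewrite nth_default// size_tuple.
Qed.

Lemma measurable_possible_times k (m : k.-tuple 'I_N) :
  measurable (possible_times m).
Proof.
rewrite possible_timesE (_ : mkset _ = \bigcap_(i in `I_k)
    [set a : k.-tuple R | nth 0 (0 :: a) i < nth 0 a i]).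
  apply: bigcap_measurableType => i _.
  rewrite -[X in measurable X]setTI.
  apply: (measurable_fun_ltr _ (measurable_nth_tuple i) measurableT
    (Y := [set true])) => //.
  case: i => [|i] /=; first exact: measurable_cst.
  exact: measurable_nth_tuple.
apply/seteqP; split=> [a /(pathP 0) + i /= ik|a aP].
  by apply; rewrite size_tuple.
by apply/(pathP 0) => i; rewrite size_tuple => ik; exact: aP.
Qed.

(** Histories have no measurable structure of their own: measurability is stated
    for each number of requests and each sequence of items, as a function of the
    arrival times. *)
Definition measurable_functional (Phi : history R N -> \bar R) :=
  forall k (m : k.-tuple 'I_N),
    measurable_fun (possible_times m) (fun a => Phi (zip a m)).

Definition measurable_process (psi : history R N -> R -> \bar R) :=
  forall k (m : k.-tuple 'I_N), measurable_fun (possible_times m `*` setT)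
    (fun z : k.-tuple R * R => psi (zip z.1 m) z.2).

(** As a request arriving at t does not influence the value at t, this value is as
    likely to be found by a request as by an observer looking at time t. *)
Definition predictable (V : Type) (psi : history R N -> R -> V) :=
  forall h t, psi h t = psi [seq r <- h | r.1 < t] t.

End HistoryMeasurability.

Section MeasurableHistories.
Context (R : realType) (N : nat) (d : measure_display) (Omega : measurableType d)
  (P : probability Omega R).
Variables (X : nat -> {RV P >-> R}) (Y : nat -> Omega -> 'I_N).

(** Unlike the requests up to a time T, the first k requests are a measurable
    function of the first k gaps and items only. *)
Definition first_requests k (w : Omega) : history R N :=
  [seq (arrival X i w, Y i w) | i <- iota 0 k].

Definition positive_gaps k (w : Omega) : bool :=
  all (fun i => 0 < X i w) (iota 0 k).

Lemma positive_gapsP k w :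
  reflect (forall i, (i < k)%N -> 0 < X i w) (positive_gaps k w).
Proof.
by apply: (iffP allP) => h i => [ik|]; [apply: h|]; rewrite mem_iota// => /h.
Qed.

Lemma arrivalS k w : arrival X k.+1 w = arrival X k w + X k.+1 w.
Proof. by rewrite /arrival big_ord_recr. Qed.

Lemma arrival0 w : arrival X 0 w = X 0%N w.
Proof. by rewrite /arrival big_ord_recl big_ord0 addr0. Qed.

Let times k w : k.-tuple R := [tuple of [seq arrival X i w | i <- iota_tuple k 0]].
Let items k w : k.-tuple 'I_N := [tuple of [seq Y i w | i <- iota_tuple k 0]].

Let tnth_times k w i : tnth (times k w) i = arrival X i w.
Proof. by rewrite tnth_map (tnth_nth 0%N)/= nth_iota. Qed.

Let tnth_items k w i : tnth (items k w) i = Y i w.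
Proof. by rewrite tnth_map (tnth_nth 0%N)/= nth_iota. Qed.

Let first_requestsE k w : first_requests k w = zip (times k w) (items k w).
Proof.
by rewrite /first_requests /times /items /=; elim: (iota 0 k) => //= ? ? ->.
Qed.

Lemma possible_first_requests k w :
  positive_gaps k w -> possible_history (first_requests k w).
Proof.
move=> /positive_gapsP Xpos.
have : possible_times (items k w) (times k w).
  rewrite possible_timesE /=; apply/(pathP 0) => i.
  rewrite size_map size_iota => ik.
  rewrite (nth_map 0%N) ?size_iota// nth_iota// add0n.
  case: i ik => [|i] ik /=; first by rewrite arrival0 Xpos.
  rewrite (nth_map 0%N) ?size_iota// 1?ltnW// nth_iota 1?ltnW// add0n.
  by rewrite arrivalS ltrDl Xpos.
by rewrite first_requestsE.
Qed.

(** The maps u and v are kept general because the gaps and items have to be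
    measurable both for the whole sigma-algebra of Omega and for the one
    generated by the first k requests. *)
Section Pullback.
Context d1 (T1 : measurableType d1) (u : T1 -> Omega) (v : T1 -> R) (k : nat).
Hypothesis mX : forall i, (i < k)%N -> measurable_fun setT (fun z => X i (u z)).
Hypothesis mY : forall i n, (i < k)%N ->
  measurable_fun setT (fun z => Y i (u z) == n).

Lemma measurable_positive_gaps : measurable_fun setT (positive_gaps k \o u).
Proof.
apply: measurable_all_seq => i; rewrite mem_iota => ik.
by apply: measurable_fun_ltr => //; exact: mX.
Qed.

Lemma measurable_arrival i : (i < k)%N ->
  measurable_fun setT (fun z => arrival X i (u z)).
Proof.
elim: i => [|i IHi] ik.
  by under eq_fun do rewrite arrival0; exact: mX.
under eq_fun do rewrite arrivalS.
by apply: measurable_funD; [exact/IHi/ltnW|exact: mX].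
Qed.

(** The sequence of items takes finitely many values: sum over them. *)
Lemma measurable_process_first_requests (psi : history R N -> R -> \bar R) :
  measurable_fun setT v -> measurable_process psi ->
  measurable_fun setT (fun z =>
    if positive_gaps k (u z) then psi (first_requests k (u z)) (v z) else 0%E).
Proof.
move=> mv mpsi.
pose g (m : k.-tuple 'I_N) (z : k.-tuple R * R) :=
  ((fun z => psi (zip z.1 m) z.2) \_ (possible_times m `*` setT)) z.
have mg m : measurable_fun setT (g m).
  apply: (measurable_restrictT _ _).1 (mpsi k m).
  by apply: measurableX => //; exact: measurable_possible_times.
rewrite (_ : (fun _ => _) = (fun z => \sum_(m : k.-tuple 'I_N)
  if positive_gaps k (u z) && (items k (u z) == m)
  then g m (times k (u z), v z) else 0)%E); last first.
  apply/funext => z; case: ifPn => [pos|_] /=; last by rewrite big1.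
  rewrite (bigD1 (items k (u z)))//= eqxx big1 ?addr0; last first.
    by move=> m; rewrite eq_sym => /negbTE ->.
  rewrite /g patchE mem_set ?first_requestsE//=; split => //=.
  by have := possible_first_requests pos; rewrite first_requestsE.
apply: emeasurable_sum => m _; apply: measurable_fun_ifT => //.
- apply: measurable_and; first exact: measurable_positive_gaps.
  under eq_fun do rewrite eqEtuple.
  rewrite (_ : (fun _ => _) = (fun z => all (fun i : 'I_k => Y i (u z) == tnth m i)
    (enum 'I_k))); last first.
    apply/funext => z; apply/forallP/allP => h i.
      by move=> _; rewrite -tnth_items.
    by rewrite tnth_items; apply: h; rewrite mem_enum.
  by apply: measurable_all_seq => i _; exact: mY.
- apply: measurableT_comp => //; apply: measurable_fun_pair => //.
  apply/measurable_fun_tnthP => i /=.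
  rewrite (_ : _ \o _ = (fun z => arrival X i (u z))).
    exact: measurable_arrival.
  by apply/funext => z /=; exact: tnth_times.
Qed.

End Pullback.
End MeasurableHistories.

Section Functionals.
Context (R : realType) (N : nat).
Implicit Types (h : history R N) (Phi : history R N -> \bar R)
  (psi : history R N -> R -> \bar R).
Local Notation leb := (@lebesgue_measure R).

Lemma history_zip h : exists k (a : k.-tuple R) (m : k.-tuple 'I_N), h = zip a m.
Proof.
exists (size h), (map_tuple fst (in_tuple h)), (map_tuple snd (in_tuple h)).
by rewrite /= -/(unzip1 h) -/(unzip2 h) zip_unzip.
Qed.

Lemma measurable_process_cst Phi :
  measurable_functional Phi -> measurable_process (fun h _ => Phi h).
Proof.
move=> mPhi k m.
apply: (measurable_comp (F := possible_times m)) (mPhi k m) _.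
- exact: measurable_possible_times.
- by move=> _ [z [? _]] <-.
- exact: measurable_funTS measurable_fst.
Qed.

Lemma measurable_process_section psi h : measurable_process psi ->
  possible_history h -> measurable_fun setT (psi h).
Proof.
have [k [a [m ->]]] := history_zip h => mpsi ha.
rewrite (_ : psi _ = (fun z : k.-tuple R * R => psi (zip z.1 m) z.2) \o pair a)//.
apply: (measurable_comp (F := possible_times m `*` setT)) (mpsi k m) _.
- by apply: measurableX => //; exact: measurable_possible_times.
- by move=> _ [t _] <-.
- exact: measurable_pair1.
Qed.

Lemma measurable_functional_sum psi n : measurable_process psi ->
  measurable_functional (fun h => \sum_(r <- h | r.2 == n) psi h r.1)%E.
Proof.
move=> mpsi k m.
rewrite (_ : (fun _ => _) = (fun a : k.-tuple R =>
    \sum_(i < k) if tnth m i == n then psi (zip a m) (tnth a i) else 0)%E); last first.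
  apply/funext => a; rewrite -[zip a m]/(val (zip_tuple a m)) big_tuple big_mkcond.
  apply: eq_bigr => i _; rewrite (tnth_nth (tnth a i, tnth m i)).
  by rewrite nth_zip ?size_tuple// -!tnth_nth.
apply: emeasurable_sum => i.
have [_|_] := boolP (tnth m i == n); last exact: measurable_cst.
rewrite (_ : (fun _ => _) = (fun z : k.-tuple R * R => psi (zip z.1 m) z.2) \o
    (fun a : k.-tuple R => (a, tnth a i)))//.
apply: (measurable_comp (F := possible_times m `*` setT)) (mpsi k m) _.
- by apply: measurableX => //; exact: measurable_possible_times.
- by move=> _ [t ? <-].
- apply: measurable_funTS; apply: measurable_fun_pair => //.
  exact: measurable_tnth.
Qed.

(** This is the measurability part of Tonelli's theorem, after an extension by 0
    outside of the possible arrival times. *)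
Lemma measurable_functional_integral psi (J : interval R) :
  measurable_process psi -> (forall h t, 0 <= psi h t)%E ->
  measurable_functional (fun h => \int[leb]_(t in [set` J]) psi h t)%E.
Proof.
move=> mpsi psi0 k m.
have mD : measurable (@possible_times R N k m `*` [set` J]).
  by apply: measurableX => //; exact: measurable_possible_times.
pose g := (fun z : k.-tuple R * R => psi (zip z.1 m) z.2) \_
  (possible_times m `*` [set` J]).
have g0 z : (0 <= g z)%E by rewrite /g patchE; case: ifP.
have mg : measurable_fun setT g.
  apply: (measurable_restrictT _ _).1 => //.
  apply: measurable_funS (mpsi k m); last by move=> z [].
  by apply: measurableX => //; exact: measurable_possible_times.
apply: (eq_measurable_fun (fun a => \int[leb]_t g (a, t))%E).
  move=> a /set_mem aD; rewrite [RHS]integral_mkcond; apply: eq_integral => t _.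
  rewrite /g !patchE; congr (if _ then _ else _).
  by apply/idP/idP; rewrite !inE => -[].
apply: measurable_funTS.
exact: (@measurable_fun_fubini_tonelli_F _ _ _ _ _ leb g).
Qed.

End Functionals.

(** * Poisson requests *)

Section PoissonRequests.
Context (R : realType) (N : nat) (d : measure_display) (Omega : measurableType d)
  (P : probability Omega R).
Variables (X : nat -> {RV P >-> R}) (Y : nat -> Omega -> 'I_N).
Variables (beta : R) (p : 'I_N -> R).
Hypotheses (beta_gt0 : 0 < beta) (XY_poisson : poisson_requests beta p X Y).

Local Notation leb := (@lebesgue_measure R).

Lemma measurable_item i (V : set 'I_N) : measurable (Y i @^-1` V).
Proof.
have [_ hY _] := XY_poisson.
rewrite -(image_id V) -bigcup_imset1 preimage_bigcup.
apply: fin_bigcup_measurable => // n _.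
by have [] := hY i n.
Qed.

Lemma measurable_gap i (U : set R) : measurable U -> measurable (X i @^-1` U).
Proof. by move=> mU; rewrite -[X in measurable X]setTI; exact: measurable_funP. Qed.

(** The pi-system of the rectangles in the first k gaps and items: it generates
    the history before the request number k. *)
Definition past_events k : set (set Omega) := [set E |
  exists U : nat -> set R, exists V : nat -> set 'I_N,
    (forall i, measurable (U i)) /\
    E = \bigcap_(i in `I_k) (X i @^-1` U i `&` Y i @^-1` V i)].

Lemma past_events_measurable k : past_events k `<=` measurable.
Proof.
move=> _ [U [V [mU ->]]]; apply: bigcap_measurableType => i _.
by apply: measurableI; [exact: measurable_gap|exact: measurable_item].
Qed.

Lemma past_eventsT k : past_events k setT.
Proof.
exists (fun=> setT), (fun=> setT); split => //.
by apply/seteqP; split.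
Qed.

Lemma past_eventsI k : setI_closed (past_events k).
Proof.
move=> _ _ [U1 [V1 [mU1 ->]]] [U2 [V2 [mU2 ->]]].
exists (fun i => U1 i `&` U2 i), (fun i => V1 i `&` V2 i); split.
  by move=> i; exact: measurableI.
rewrite -bigcapI; apply: eq_bigcapr => i _.
by rewrite !preimage_setI setIACA.
Qed.

Local Notation past k := (g_sigma_algebraType (past_events k)).

Lemma past_measurable_gap k i : (i < k)%N ->
  measurable_fun setT (X i : past k -> R).
Proof.
move=> ik _ U mU; rewrite setTI; apply: sub_sigma_algebra.
exists (fun j => if j == i then U else setT), (fun=> setT); split.
  by move=> j; case: ifP.
apply/seteqP; split=> [w Uw j jk|w /(_ i ik) []]; last by rewrite eqxx.
by split => //=; case: eqP => [->|].
Qed.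

Lemma past_measurable_item k i n : (i < k)%N ->
  measurable_fun setT (fun w : past k => Y i w == n).
Proof.
move=> ik mT; apply: (measurable_fun_bool true) mT.
rewrite setTI; apply: sub_sigma_algebra.
exists (fun=> setT), (fun j => if j == i then [set n] else setT); split => //.
apply/seteqP; split=> [w /eqP Yw j jk|w /(_ i ik) []].
  by split => //=; case: eqP => [->|].
by rewrite eqxx => _ /= ->; exact: eqxx.
Qed.

Lemma past_events_indep k (V : set 'I_N) (E : set Omega) (U : set R) :
  past_events k E -> measurable U ->
  P (E `&` Y k @^-1` V `&` X k @^-1` U) =
    (P (Y k @^-1` V) * P E * exponential_law beta_gt0 U)%E.
Proof.
have [hX _ hI] := XY_poisson.
move=> [U0 [V0 [mU0 ->]]] mU.
pose U1 i := if i == k then U else U0 i.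
pose V1 i := if i == k then V else V0 i.
have mU1 i : measurable (U1 i) by rewrite /U1; case: ifP.
transitivity (P (\bigcap_(i in `I_k.+1) (X i @^-1` U1 i `&` Y i @^-1` V1 i))).
  congr (P _); apply/seteqP; split=> w.
    move=> [[wk Yk] Xk] i /=; rewrite ltnS leq_eqVlt /U1 /V1.
    by case: eqP => [-> //|_ /=]; exact: wk.
  move=> h; split; first split.
  - move=> i /= ik; have := h i (ltnW ik); rewrite /U1 /V1.
    by rewrite (ltn_eqF ik).
  - by have [] := h k (ltnSn k); rewrite /U1 /V1 eqxx.
  - by have [] := h k (ltnSn k); rewrite /U1 /V1 eqxx.
rewrite hI// hI// big_ord_recr/=.
rewrite [U1 k]/U1 [V1 k]/V1 eqxx.
rewrite (_ : P (X k @^-1` U) = exponential_law beta_gt0 U); last exact: (hX k).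
rewrite [in RHS]muleAC muleC; congr (_ * _)%E; first by rewrite muleC.
apply: eq_bigr => i _.
by rewrite /U1 /V1 (ltn_eqF (ltn_ord i)).
Qed.

(** The gap number k is exponential, and independent of the earlier requests
    and of its own item. *)
Lemma integral_past k (V : set 'I_N) (c : {nonneg R}) (f : past k * R -> \bar R) :
  P (Y k @^-1` V) = c%:num%:E ->
  measurable_fun setT f -> (forall z, 0 <= f z)%E ->
  (\int[P]_(w in Y k @^-1` V) f (w, X k w) =
   c%:num%:E * \int[P]_w \int[exponential_law beta_gt0]_x f (w, x))%E.
Proof.
move=> cE mf f0.
apply: integral_indep_past => //.
- exact: past_events_measurable.
- exact: past_eventsT.
- exact: past_eventsI.
- exact: measurable_item.
- have mX : measurable_fun setT (X k) by [].
  by move=> mT U mU; exact (mX mT U mU).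
- by move=> E U GE mU; rewrite past_events_indep// cE.
Qed.

End PoissonRequests.

Section AlmostSure.
Context (R : realType) (N : nat) (d : measure_display) (Omega : measurableType d)
  (P : probability Omega R).
Variables (X : nat -> {RV P >-> R}) (Y : nat -> Omega -> 'I_N).
Variables (beta : R) (p : 'I_N -> R).
Hypotheses (beta_gt0 : 0 < beta) (XY_poisson : poisson_requests beta p X Y).

(** The paths on which [nb_requests] counts the arrivals. *)
Definition regular (w : Omega) : Prop :=
  (forall i, 0 < X i w) /\ (forall T : R, exists k, T < arrival X k w).

Lemma gap_tail i c : 0 <= c ->
  P (X i @^-1` `[c, +oo[%classic) = (expR (- beta * c))%:E.
Proof.
move=> c0; have [hX _ _] := XY_poisson.
rewrite -(exponential_tail beta_gt0 (exponential_lawE beta_gt0))//.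
by rewrite exponential_lawE// -(hX i).
Qed.

Let le0_negligible i : P.-negligible (X i @^-1` `]-oo, 0]%classic).
Proof.
have [hX _ _] := XY_poisson.
apply/negligibleP; first exact: measurable_gap.
rewrite -[RHS](exponential_neg (exponential_lawE beta_gt0)) exponential_lawE//.
by rewrite -(hX i).
Qed.

(** Independent gaps do not all stay below c: the probability that the first K do
    is [q ^+ K], with [q < 1]. *)
Let bounded_gaps_negligible (c : R) : 0 <= c ->
  P.-negligible (\bigcap_i (X i @^-1` `]-oo, c[%classic)).
Proof.
move=> c0; have [_ hY hI] := XY_poisson.
pose q := 1 - expR (- beta * c).
have q01 : 0 <= q < 1.
  rewrite subr_ge0 ltrBlDr ltrDl expR_gt0 andbT -[leRHS]expR0 ler_expR.
  by rewrite mulNr oppr_le0 mulr_ge0// ltW.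
have mI i : measurable (X i @^-1` `]-oo, c[%classic) by exact: measurable_gap.
have Pi i : P (X i @^-1` `]-oo, c[%classic) = q%:E.
  rewrite -setCitvr preimage_setC probability_setC ?gap_tail//.
  exact: (measurable_gap X i (measurable_itv `[c, +oo[)).
have PK K : (P (\bigcap_(i in `I_K) (X i @^-1` `]-oo, c[%classic)) = (q ^+ K)%:E)%E.
  transitivity (P (\bigcap_(i in `I_K) (X i @^-1` `]-oo, c[%classic `&` Y i @^-1` setT))).
    by congr (P _); apply: eq_bigcapr => i _; rewrite preimage_setT setIT.
  rewrite hI//; elim: K => [|K IHK]; first by rewrite big_ord0.
  rewrite big_ord_recr/= IHK preimage_setT probability_setT mule1 exprSr EFinM.
  by rewrite -(Pi K).
apply/negligibleP; first exact: bigcap_measurableType.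
apply/eqP; rewrite eq_le measure_ge0 andbT.
have : (fun K => (q ^+ K)%:E) @ \oo --> (0 : R)%:E.
  apply: cvg_EFin; first exact: nearW.
  by apply: cvg_expr; case/andP: q01 => ? ?; rewrite ger0_norm.
move=> q0; apply: cvge_ge q0; apply: nearW => K.
rewrite -PK; apply: le_measure; rewrite ?inE.
- exact: bigcap_measurableType.
- exact: bigcap_measurableType.
- by move=> w wX i _; exact: wX.
Qed.

(** If the arrivals are bounded, then so are the gaps. *)
Lemma regular_ae : P.-negligible (~` regular).
Proof.
apply: (negligibleS (A := (\bigcup_i X i @^-1` `]-oo, 0]%classic) `|`
    \bigcup_n \bigcap_i (X i @^-1` `]-oo, n%:R[%classic))); last first.
  by apply: negligibleU; apply: negligible_bigcup => i;
    [exact: le0_negligible|exact: bounded_gaps_negligible].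
move=> w; apply: contra_notP => /not_orP[w1 w2].
have Xpos i : 0 < X i w.
  by rewrite ltNge; apply/negP => Xi; apply: w1; exists i; rewrite //= in_itv.
split=> // T.
apply: contrapT => /forallNP hT; apply: w2.
exists (Num.truncn `|T|).+1 => // i _ /=; rewrite in_itv/=.
apply: le_lt_trans (truncnS_gt _).
apply: le_trans (ler_norm _).
have := hT i; move/negP; rewrite -leNgt; apply: le_trans.
case: i => [|i]; first by rewrite arrival0.
rewrite arrivalS lerDr /arrival; apply: sumr_ge0 => j _; exact/ltW/Xpos.
Qed.

End AlmostSure.

Section RequestsUpTo.
Context (R : realType) (N : nat) (d : measure_display) (Omega : measurableType d)
  (P : probability Omega R).
Variables (X : nat -> {RV P >-> R}) (Y : nat -> Omega -> 'I_N).

Lemma ltn_arrival w : (forall i, 0 < X i w) ->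
  {homo (fun k => arrival X k w) : i j / (i < j)%N >-> i < j}.
Proof.
move=> Xpos; apply: homo_ltn => [|k]; first exact: lt_trans.
by rewrite arrivalS ltrDl Xpos.
Qed.

Lemma nb_requestsP T w k :
  nb_requests X T w = k -> (0 < k)%N ->
  (forall i, 0 < X i w) /\ forall i, (arrival X i w <= T) = (i < k)%N.
Proof. by rewrite /nb_requests; case: xgetP => [y _ hy <- _|_ <-]. Qed.

Lemma nb_requestsE T w k :
  (forall i, 0 < X i w) -> (forall i, (arrival X i w <= T) = (i < k)%N) ->
  nb_requests X T w = k.
Proof.
move=> Xpos hk; rewrite /nb_requests; apply: xget_subset1; first by split.
move=> i j [_ hi] [_ hj].
have e l : (l < i)%N = (l < j)%N by rewrite -hi -hj.
by case: (ltngtP i j) => // [ij|ji]; [have := e i|have := e j]; rewrite ltnn ?ij ?ji.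
Qed.

Lemma regular_nb_requests T w : regular X w ->
  forall i, (arrival X i w <= T) = (i < nb_requests X T w)%N.
Proof.
case=> Xpos unbounded; have [K0 TK0] := unbounded T.
have [k Tk kmin] := ex_minnP (ex_intro (fun K => T < arrival X K w) _ TK0).
suff hk i : (arrival X i w <= T) = (i < k)%N.
  by rewrite (nb_requestsE Xpos hk).
have [ik|ki] := ltnP i k.
  by rewrite leNgt; apply/negP => /kmin; rewrite leqNgt ik.
apply/negbTE; rewrite -ltNge; apply: lt_le_trans Tk _.
move: ki; rewrite leq_eqVlt => /predU1P[->//|ki].
exact/ltW/ltn_arrival.
Qed.

Lemma nb_requests_positive_gaps T w : positive_gaps X (nb_requests X T w) w.
Proof.
apply/positive_gapsP => i ik.
have [] := @nb_requestsP T w _ erefl (leq_ltn_trans (leq0n i) ik).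
by move=> + _; apply.
Qed.

Lemma possible_requests T w : possible_history (requests X Y T w).
Proof.
exact: possible_first_requests (nb_requests_positive_gaps T w).
Qed.

Lemma requests_le T w r : r \in requests X Y T w -> r.1 <= T.
Proof.
move=> /mapP[k]; rewrite mem_iota /= add0n => kn -> /=.
by have [_ ->] := @nb_requestsP T w _ erefl (leq_ltn_trans (leq0n k) kn).
Qed.

Lemma measurable_nb_requests T k : measurable [set w | nb_requests X T w = k].
Proof.
have mb (b : Omega -> bool) (c : bool) : measurable_fun setT b ->
    measurable [set w | b w = c].
  by move=> mb; rewrite -[X in measurable X]setTI; exact: (mb measurableT [set c]).
have marr i : measurable_fun setT (arrival X i).
  exact: (@measurable_arrival _ _ _ _ _ _ _ id i.+1).
have mk j : (0 < j)%N -> measurable [set w | nb_requests X T w = j].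
  move=> j0; rewrite (_ : mkset _ = \bigcap_i ([set w | (0 < X i w) = true] `&`
      [set w | (arrival X i w <= T) = (i < j)%N])).
    apply: bigcap_measurableType => i _; apply: measurableI; apply: mb.
      exact: measurable_fun_ltr.
    exact: measurable_fun_ler.
  apply/seteqP; split=> w /=.
    by move=> /nb_requestsP-/(_ j0)[Xpos hj] i _; split; [exact: Xpos|exact: hj].
  by move=> h; apply: nb_requestsE => i; have [/=] := h i Logic.I.
case: k => [|k]; last exact: mk.
rewrite (_ : mkset _ = ~` \bigcup_j [set w | nb_requests X T w = j.+1]).
  by apply: measurableC; apply: bigcup_measurable => j _; exact: mk.
apply/seteqP; split=> w /=; first by move=> w0 [j _] /=; rewrite w0.
by case E : (nb_requests X T w) => [//|j] []; exists j.
Qed.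

(** Cut along the number of requests, on which the history is a fixed number of
    first requests. *)
Lemma measurable_requests T (Phi : history R N -> \bar R) :
  (forall i V, measurable (Y i @^-1` V)) -> measurable_functional Phi ->
  measurable_fun setT (fun w => Phi (requests X Y T w)).
Proof.
move=> mY mPhi _ U mU; rewrite setTI.
pose Psi k w := if positive_gaps X k w then Phi (first_requests X Y k w) else 0%E.
have mPsi k : measurable_fun setT (Psi k).
  apply: (@measurable_process_first_requests _ _ _ _ _ X Y _ _ id (cst 0) k _ _
    (fun h _ => Phi h)) => //; last exact: measurable_process_cst.
  move=> i n _ mT; apply: (measurable_fun_bool true) mT; rewrite setTI.
  rewrite (_ : _ @^-1` _ = Y i @^-1` [set n])//.
  by apply/seteqP; split=> w /= /eqP.
rewrite (_ : _ @^-1` _ = \bigcup_k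
    ([set w | nb_requests X T w = k] `&` Psi k @^-1` U)).
  apply: bigcup_measurable => k _; apply: measurableI.
    exact: measurable_nb_requests.
  by rewrite -[X in measurable X]setTI; exact: mPsi.
have PsiE w : Psi (nb_requests X T w) w = Phi (requests X Y T w).
  by rewrite /Psi nb_requests_positive_gaps.
apply/seteqP; split=> w /=; first by rewrite -PsiE; exists (nb_requests X T w).
by move=> [k _ [/= <-]]; rewrite PsiE.
Qed.

(** Between the arrivals number [k - 1] (excluded) and [k] (included), the history
    strictly before t consists of the first k requests. *)
Lemma requests_before T w k t : regular X w ->
  arrival X k w - X k w < t <= arrival X k w -> t <= T ->
  [seq r <- requests X Y T w | r.1 < t] = first_requests X Y k w.
Proof.
move=> wreg /andP[kt tk] tT; have [Xpos _] := wreg.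
have arr i : (arrival X i w < t) = (i < k)%N.
  have [ik|ki] := ltnP i k.
    apply: le_lt_trans kt; case: k ik {tk} => // k ik.
    rewrite arrivalS addrK; move: ik; rewrite ltnS leq_eqVlt => /predU1P[->//|ik].
    exact/ltW/ltn_arrival.
  apply/negbTE; rewrite -leNgt; apply: le_trans tk _.
  by move: ki; rewrite leq_eqVlt => /predU1P[->//|ki]; exact/ltW/ltn_arrival.
have kn : (k <= nb_requests X T w)%N.
  rewrite leqNgt; apply/negP => nk.
  have := regular_nb_requests T wreg (nb_requests X T w).
  by rewrite ltnn (le_trans (ltW _) tT)// arr.
rewrite /requests filter_map /= -(subnKC kn) iotaD filter_cat add0n map_cat.
rewrite (_ : seq.filter _ (iota 0 k) = iota 0 k).
  rewrite (_ : seq.filter _ (iota k _) = [::]) ?cats0//.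
  apply/eqP; rewrite -(negbK (_ == _)) -has_filter; apply/hasPn => i /=.
  by rewrite mem_iota arr -leqNgt => /andP[].
by apply/all_filterP/allP => i /=; rewrite mem_iota arr.
Qed.

End RequestsUpTo.

(** * Expected sums over Poisson requests *)

Section LebesgueShift.
Context (R : realType).
Local Notation leb := (@lebesgue_measure R).

Lemma lebesgue_measure_shift (s : R) (A : set R) : measurable A ->
  pushforward leb ((fun x => s + x) : _ -> measurableTypeR R) A = leb A.
Proof.
move=> mA; apply/esym/lebesgue_measure_unique => //=.
  move=> mT U mU; have ms : measurable_fun setT (fun x : R => s + x).
    exact: measurable_funD.
  exact: (ms mT U mU).
move=> _ _ [[a b] _ <-].
rewrite /pushforward.
rewrite (_ : _ @^-1` _ = `]a - s, b - s]%classic).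
  rewrite !lebesgue_measure_itv/= !lte_fin ltrD2r.
  by case: ifP => // _; rewrite -!EFinD; congr EFin; lra.
by apply/seteqP; split=> x /=; rewrite !in_itv/= => /andP[? ?]; apply/andP; split; lra.
Qed.

Lemma integral_shift (s c : R) (f : R -> \bar R) :
  measurable_fun setT f -> (forall x, 0 <= f x)%E ->
  (\int[leb]_(x in `[0%R, c]) f (s + x)%R =
   \int[leb]_(t in `]s, (s + c)%R]) f t)%E.
Proof.
move=> mf f0.
have ms0 : measurable_fun setT (fun x : R => s + x) by exact: measurable_funD.
have ms : measurable_fun (setT : set (measurableTypeR R))
    ((fun x => s + x) : measurableTypeR R -> measurableTypeR R).
  by move=> mT U mU; exact: (ms0 mT U mU).
rewrite -integral_itv_obnd_cbnd; last first.
  by apply: measurable_funTS; exact: measurableT_comp.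
rewrite (_ : `]0, c]%classic =
    ((fun x => s + x) : _ -> measurableTypeR R) @^-1` `]s, s + c]%classic).
  rewrite -(ge0_integral_pushforward ms leb (D := `]s, s + c]%classic) (f := f))//.
    by apply: eq_measure_integral => A mA _; exact: lebesgue_measure_shift.
  exact: measurable_funTS.
by apply/seteqP; split=> x /=; rewrite !in_itv/= => /andP[? ?]; apply/andP; split; lra.
Qed.

End LebesgueShift.

Section Campbell.
Local Open Scope ereal_scope.
Context (R : realType) (N : nat) (d : measure_display) (Omega : measurableType d)
  (P : probability Omega R).
Variables (X : nat -> {RV P >-> R}) (Y : nat -> Omega -> 'I_N).
Variables (beta : R) (p : 'I_N -> R).
Hypotheses (beta_gt0 : (0 < beta)%R) (p_gt0 : forall n, (0 < p n)%R)
  (XY_poisson : poisson_requests beta p X Y).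
Variables (n : 'I_N) (T : R) (psi : history R N -> R -> \bar R).
Hypotheses (mpsi : measurable_process psi)
  (psi_ge0 : forall h t, 0 <= psi h t) (psi_pred : predictable psi).

Local Notation leb := (@lebesgue_measure R).
Local Notation past k := (g_sigma_algebraType (past_events X Y k)).

(** S k is the time of the last arrival before the gap number k, hence 0 for
    [k = 0]. *)
Let S k (w : Omega) : R := (\sum_(i < k) X i w)%R.

Let arrivalE k w : arrival X k w = (S k w + X k w)%R.
Proof. by rewrite /arrival big_ord_recr. Qed.

(** The value of psi at a request arriving after a gap [z.2], the earlier requests
    being those of [z.1]. It reads only the first k requests; this is where
    predictability enters. *)
Let F k (z : past k * R) : \bar R :=
  if (S k z.1 + z.2 <= T)%R then
    if positive_gaps X k z.1 then
      psi (first_requests X Y k z.1) (S k z.1 + z.2)%R else 0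
  else 0.

Let F_ge0 k z : 0 <= F (k := k) z.
Proof. by rewrite /F; case: ifP => // _; case: ifP. Qed.

Let measurable_F k : measurable_fun setT (F (k := k)).
Proof.
have mX i : (i < k)%N -> measurable_fun setT (fun z : past k * R => X i z.1).
  by move=> ik; apply: measurableT_comp => //; exact: past_measurable_gap.
have mY i m : (i < k)%N -> measurable_fun setT (fun z : past k * R => Y i z.1 == m).
  move=> ik; apply: (measurableT_comp (f := fun w : past k => Y i w == m)) => //.
  exact: past_measurable_item.
have mS : measurable_fun setT (fun z : past k * R => S k z.1 + z.2)%R.
  apply: measurable_funD => //; rewrite /S.
  by apply: measurable_sum => i; exact: mX.
apply: measurable_fun_ifT => //; first exact: measurable_fun_ler.
apply: (@measurable_process_first_requests _ _ _ _ _ X Y _ _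
  (fst : past k * R -> Omega) (fun z => S k z.1 + z.2)%R k) => //.
Qed.

(** What psi accumulates during the gap [z.2]. *)
Let G k (z : past k * R) : \bar R := \int[leb]_(t in `[0%R, z.2]) F (z.1, t).

Let G_ge0 k z : 0 <= G (k := k) z.
Proof. exact: integral_ge0. Qed.

Let measurable_G k : measurable_fun setT (G (k := k)).
Proof.
pose h (z : (past k * R) * R) : \bar R :=
  if (0 <= z.2 <= z.1.2)%R then F (z.1.1, z.2) else 0.
have mh : measurable_fun setT h.
  apply: measurable_fun_ifT => //=.
    apply: measurable_and; first exact: measurable_fun_ler.
    apply: measurable_fun_ler => //; exact: measurableT_comp.
  apply: measurableT_comp; first exact: measurable_F.
  by apply: measurable_fun_pair => //; exact: measurableT_comp.
rewrite (_ : G (k := k) = fubini_F leb h).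
  apply: measurable_fun_fubini_tonelli_F => //.
  by move=> z; rewrite /h; case: ifP.
apply/funext => z; rewrite /G /fubini_F [LHS]integral_mkcond.
by apply: eq_integral => t _; rewrite patchE /h/= mem_setE in_itv.
Qed.

(** The contributions of the request number k to the sum over the requests for n,
    and of the gap before it to the integral of psi. *)
Let served k (w : Omega) : \bar R := if Y k w == n then F (k := k) (w, X k w) else 0.
Let waited k (w : Omega) : \bar R := G (k := k) (w, X k w).

Let measurable_pull k (f : past k * R -> \bar R) : measurable_fun setT f ->
  measurable_fun setT (fun w : Omega => f (w : past k, X k w)).
Proof.
move=> mf.
apply: measurableT_comp mf _; apply: measurable_fun_pair => //.
exact: (measurable_id_past (past_events_measurable XY_poisson (k:=k))).
Qed.

Let item_lawT k : P (Y k @^-1` setT) = (1%:nng : {nonneg R})%:num%:E.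
Proof. by rewrite preimage_setT probability_setT. Qed.

Let item_law k : P (Y k @^-1` [set n]) = (NngNum (ltW (p_gt0 n)))%:num%:E.
Proof. by have [_ /(_ k n)[_ ->] _] := XY_poisson. Qed.

Let integral_served k :
  \int[P]_w served k w = (beta * p n)%:E * \int[P]_w waited k w.
Proof.
transitivity (\int[P]_(w in Y k @^-1` [set n]) F (k := k) (w, X k w)).
  rewrite [RHS]integral_mkcond; apply: eq_integral => w _.
  rewrite patchE /served; congr (if _ then _ else _).
  by apply/eqP/idP => [|/set_mem//] Yw; exact: mem_set.
rewrite (integral_past beta_gt0 XY_poisson (item_law k) (measurable_F (k := k)) (@F_ge0 k)).
rewrite -[\int[P]_w waited k w](_ : \int[P]_(w in Y k @^-1` setT) waited k w = _);
  last by rewrite preimage_setT.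
rewrite (integral_past beta_gt0 XY_poisson (item_lawT k))// mul1e.
rewrite [(beta * _)%R]mulrC EFinM -muleA; congr (_ * _).
rewrite -ge0_integralZl//; last 3 first.
- apply: (measurable_past (past_events_measurable XY_poisson (k:=k))).
  have mG : measurable_fun (setT : set (past k * measurableTypeR R)) (G (k := k)).
    by move=> mT U mU; exact: (measurable_G mT mU).
  exact: (measurable_fun_fubini_tonelli_F (m2 := exponential_law beta_gt0) _ mG
    (@G_ge0 k)).
- by move=> w _; exact: integral_ge0.
- by rewrite lee_fin ltW.
apply: eq_integral => w _.
rewrite (exponential_compensator beta_gt0 (exponential_lawE beta_gt0))//.
exact: (measurableT_comp (measurable_F (k := k)) (pair1_measurable (w : past k))).
Qed.

Let sum_served w : regular X w ->
  \sum_(r <- requests X Y T w | r.2 == n) psi (requests X Y T w) r.1 =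
  \sum_(k <oo) served k w.
Proof.
move=> wreg; have [Xpos _] := wreg.
have nbE := regular_nb_requests T wreg.
rewrite (@nneseries_split _ _ 0 (nb_requests X T w)); last first.
  by move=> k _; rewrite /served; case: ifP.
rewrite [X in _ + X]eseries0 ?adde0; last first.
  move=> k; rewrite add0n => nk _; rewrite /served /F /= -arrivalE nbE ltnNge nk.
  by case: ifP.
rewrite add0n /index_iota subn0 {1}/requests big_map big_mkcond /=.
apply: eq_big_seq => k; rewrite mem_iota add0n => /= kn.
rewrite /served /F /= -arrivalE nbE kn.
have -> : positive_gaps X k w by apply/positive_gapsP.
case: ifP => // _; rewrite psi_pred (requests_before Y (k := k) wreg)//.
  by rewrite lexx ltrBlDr ltrDl Xpos.
by rewrite nbE.
Qed.

Let integral_waited w : regular X w ->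
  \int[leb]_(t in `[0%R, T]) psi (requests X Y T w) t = \sum_(k <oo) waited k w.
Proof.
move=> wreg; have [Xpos unbounded] := wreg.
pose h t := if (t <= T)%R then psi (requests X Y T w) t else 0.
have mpsih hh : possible_history hh ->
    measurable_fun setT (fun t : R => if (t <= T)%R then psi hh t else 0).
  move=> hhP; apply: measurable_fun_ifT => //; first exact: measurable_fun_ler.
  exact: measurable_process_section.
have h0 t : 0 <= h t by rewrite /h; case: ifP.
have mh : measurable_fun setT h by apply: mpsih; exact: possible_requests.
have waitedE k : waited k w = \int[leb]_(t in `](S k w), (S k w + X k w)%R]) h t.
  have pos : positive_gaps X k w by apply/positive_gapsP.
  pose hk t := if (t <= T)%R then psi (first_requests X Y k w) t else 0.
  rewrite /waited /G /= (_ : \int[leb]_(t in _) _ =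
      \int[leb]_(t in `[0%R, X k w]) hk (S k w + t)%R); last first.
    by apply: eq_integral => t _; rewrite /F /hk /= pos.
  rewrite integral_shift//; first last.
  - by move=> t; rewrite /hk; case: ifP.
  - by apply: mpsih; exact: possible_first_requests.
  apply: eq_integral => t /set_mem; rewrite /= in_itv/= => /andP[kt tk].
  rewrite /hk /h; case: ifP => // tT.
  rewrite [RHS]psi_pred (requests_before Y (k := k) wreg)// arrivalE addrK.
  by rewrite kt.
rewrite (eq_eseriesr (fun k _ => waitedE k)).
have posS k : (0 <= S k w)%R by apply: sumr_ge0 => i _; exact/ltW/Xpos.
rewrite -ge0_integral_bigcup//; first last.
- apply/trivIsetP => i j _ _; wlog ij : i j / (i < j)%N.
    move=> hw; case: (ltngtP i j) => // [ij _|ji _].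
      by apply: (hw _ _ ij); rewrite ltn_eqF.
    by rewrite setIC; apply: (hw _ _ ji); rewrite ltn_eqF.
  move=> _; apply/seteqP; split=> // t [] /=; rewrite !in_itv/= => /andP[_ ti] /andP[jt _].
  have := lt_le_trans jt ti => {ti jt}.
  rewrite -arrivalE ltNge => /negP; apply; case: j ij => // j.
  rewrite ltnS leq_eqVlt => /predU1P[->//|ij].
  exact/ltW/(ltn_arrival Xpos).
- exact: measurable_funTS.
have -> : \bigcup_k `](S k w), (S k w + X k w)%R]%classic = `]0%R, +oo[%classic.
  apply/seteqP; split=> t /=.
    move=> [k _] /=; rewrite !in_itv/= andbT => /andP[kt _].
    exact: le_lt_trans (posS k) kt.
  rewrite in_itv/= andbT => t0.
  have [K0 tK0] := unbounded t.
  have [k tk kmin] := ex_minnP (ex_intro (fun K => t <= arrival X K w)%R K0 (ltW tK0)).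
  exists k => //=; rewrite in_itv/= -arrivalE tk andbT.
  case: k tk kmin => [|k] _ kmin; first by rewrite /S big_ord0.
  by rewrite ltNge; apply/negP => /kmin; rewrite ltnn.
rewrite -integral_itv_obnd_cbnd; last first.
  by apply: measurable_funTS; apply: measurable_process_section => //;
    exact: possible_requests.
rewrite [LHS]integral_mkcond [RHS]integral_mkcond; apply: eq_integral => t _.
rewrite !patchE /h !mem_setE !in_itv/= andbT.
by case: (0 < t)%R => //; case: (t <= T)%R.
Qed.

(** Campbell's formula for predictable processes, also known as PASTA: Poisson
    arrivals see time averages. It holds for the contribution of every single gap
    ([integral_served]); almost surely, these contributions add up to the two
    sides. *)
Lemma expected_sum_over_requests :
  \int[P]_w \sum_(r <- requests X Y T w | r.2 == n) psi (requests X Y T w) r.1 =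
  (beta * p n)%:E *
  \int[P]_w \int[leb]_(t in `[0%R, T]) psi (requests X Y T w) t.
Proof.
have served_ge0 k w : 0 <= served k w by rewrite /served; case: ifP.
have mserved k : measurable_fun setT (served k).
  apply: measurable_fun_ifT => //; last exact: (measurable_pull (measurable_F (k := k))).
  apply: (measurable_fun_bool true); rewrite setTI.
  rewrite (_ : _ @^-1` _ = Y k @^-1` [set n]); first exact: (measurable_item XY_poisson).
  by apply/seteqP; split=> w /= /eqP.
have mwaited k : measurable_fun setT (waited k).
  exact: (measurable_pull (measurable_G (k := k))).
have mY i V : measurable (Y i @^-1` V) by exact: (measurable_item XY_poisson).
have ae_regular (f g : Omega -> \bar R) : (forall w, regular X w -> f w = g w) ->
    ae_eq P setT f g.
  move=> fg; apply: negligibleS (regular_ae beta_gt0 XY_poisson) => w /=.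
  by apply: contra_not => wreg _; exact: fg.
transitivity (\int[P]_w \sum_(k <oo) served k w).
  apply: ge0_ae_eq_integral => //.
  - exact: (measurable_requests X T mY (measurable_functional_sum n mpsi)).
  - by apply: (ge0_emeasurable_sum (P := xpredT)).
  - by move=> w _; exact: sume_ge0.
  - by move=> w _; exact: nneseries_ge0.
  - by apply: ae_regular => w; exact: sum_served.
rewrite integral_nneseries//.
rewrite (eq_eseriesr (fun k _ => integral_served k)).
rewrite nneseriesZl; last by move=> k _; apply: integral_ge0 => w _; exact: G_ge0.
congr (_ * _); rewrite -integral_nneseries//; last by move=> k w _; exact: G_ge0.
apply/esym/ge0_ae_eq_integral => //.
- exact: (measurable_requests X T mY (measurable_functional_integral `[0%R, T] mpsi psi_ge0)).
- by apply: (ge0_emeasurable_sum (P := xpredT)) => // k w _ _; exact: G_ge0.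
- by move=> w _; exact: integral_ge0.
- by move=> w _; apply: nneseries_ge0 => k _ _; exact: G_ge0.
- by apply: ae_regular => w; exact: integral_waited.
Qed.

End Campbell.

(** * The state of a policy, and the cost and storage of one item *)

Section PolicyState.
Context (R : realType) (N : nat).
Implicit Types (pi : policy R N) (h : history R N) (n : 'I_N).
Local Notation leb := (@lebesgue_measure R).

Lemma upto_before h s t : s < t -> upto [seq r <- h | r.1 < t] s = upto h s.
Proof.
move=> st; rewrite /upto -filter_predI; apply: eq_filter => r /=.
by apply: andb_idr => /le_lt_trans; apply.
Qed.

Lemma predictable_stored pi n : predictable (fun h t => stored pi h t n).
Proof.
move=> h t; rewrite /stored; apply: asbool_equiv_eq.
by split=> -[f [ft fetch keep]]; exists f; split=> //;
  [move: fetch; rewrite /fetch_at upto_before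
  |move=> s /andP[fs st]; have := keep s; rewrite fs st /evict_at upto_before//; apply
  |move: fetch; rewrite /fetch_at upto_before
  |move=> s /andP[fs st]; have := keep s; rewrite fs st /evict_at upto_before//; apply].
Qed.

Lemma predictable_elapsed pi n : predictable (fun h t => elapsed pi h t n).
Proof.
move=> h t; rewrite /elapsed; congr (_ - sup _).
by apply/seteqP; split=> f /= [ft]; rewrite /fetch_at upto_before.
Qed.

Lemma elapsed_ge0 pi h t n : 0 <= t -> 0 <= elapsed pi h t n.
Proof.
move=> t0; rewrite subr_ge0.
have [->|/set0P ne] := eqVneq [set f | f < t /\ fetch_at pi h f n] set0.
  by rewrite sup0.
by apply: ge_sup => // f [/ltW].
Qed.

Lemma stored_gt0 pi h t n : stored pi h t n -> 0 < t.
Proof.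
by move=> /asboolP[f [ft /andP[f0 _] _]]; exact: le_lt_trans ft.
Qed.

(** Infinitely many fetches cost [+oo]; otherwise they can be listed. *)
Lemma nfetchP pi h T n :
  nfetch pi h T n = +oo%E \/
  exists s : seq R, [/\ uniq s, (forall f, f \in s = (f <= T) && fetch_at pi h f n)
    & nfetch pi h T n = (size s)%:R%:E].
Proof.
rewrite /nfetch; set A := mkset _.
have [finA|infA] := pselect (finite_set A); last first.
  left; apply/eqyP => x x0.
  have [B BA cardB] := infinite_set_fset (Num.truncn x).+1 infA.
  apply: esum_ge; exists [set` finmap.enum_fset B].
    by split; [exact: finite_seq|exact: BA].
  rewrite -fsbig_seq ?finmap.fset_uniq// sumEFin lee_fin big_const_seq count_predT.
  rewrite iter_addr_0; apply/ltW/(lt_le_trans (truncnS_gt x)).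
  by rewrite ler_nat.
right; exists (finmap.enum_fset (fset_set A)); split; first exact: finmap.fset_uniq.
  move=> f; transitivity (f \in A); first exact: in_fset_set.
  by apply/idP/idP => [/set_mem[-> ->]//|/andP[? ?]]; exact/mem_set.
exact: finite_card_sum.
Qed.

Lemma possible_history_uniq h : possible_history h -> uniq (unzip1 h).
Proof.
move=> hP; apply: (@subseq_uniq _ _ (0 :: unzip1 h)); first exact: subseq_cons.
exact: (sorted_uniq lt_trans ltxx).
Qed.

(** There may be more fetches than this: a policy can fetch without a request. *)
Lemma served_fetches_le pi h T n : possible_history h ->
  (forall r, r \in h -> r.1 <= T) ->
  ((\sum_(r <- h | (r.2 == n) && fetch_at pi h r.1 n) 1)%:E <= nfetch pi h T n)%E.
Proof.
move=> hP hT.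
have uh := possible_history_uniq hP.
pose s := [seq r.1 | r <- h & (r.2 == n) && fetch_at pi h r.1 n].
have us : uniq s by apply: subseq_uniq uh; apply: map_subseq; exact: filter_subseq.
apply: esum_ge; exists [set` s].
  split; first exact: finite_seq.
  by move=> f /= /mapP[r]; rewrite mem_filter => /andP[/andP[_ fr] rh] ->; split; [exact: hT|].
by rewrite -fsbig_seq// big_map big_filter sumEFin.
Qed.

Lemma le_seq_max (s : seq R) x0 : x0 \in s ->
  exists2 m, m \in s & forall x, x \in s -> x <= m.
Proof.
elim: s x0 => // x s IHs x0 _.
case: s IHs => [_|y s /(_ y (mem_head _ _))[m ms mmax]].
  by exists x; rewrite ?mem_head// => z; rewrite inE => /eqP ->.
have [xm|mx] := leP x m.
  exists m; first by rewrite inE ms orbT.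
  by move=> z; rewrite inE => /predU1P[->//|]; exact: mmax.
exists x; first exact: mem_head.
by move=> z; rewrite inE => /predU1P[->//|/mmax/le_lt_trans/(_ mx)/ltW].
Qed.

(** With finitely many fetches, the supremum in [elapsed] is attained. *)
Lemma stored_last_fetch pi h T n (s : seq R) t :
  (forall f, f \in s = (f <= T) && fetch_at pi h f n) -> t <= T ->
  stored pi h t n -> exists f, [/\ f \in s, f < t & elapsed pi h t n = t - f].
Proof.
move=> sE tT /asboolP[f0 [f0t f0fetch _]].
have mem f : f \in [seq f <- s | f < t] = (f < t) && fetch_at pi h f n.
  rewrite mem_filter sE; case: ltP => //= ft.
  by rewrite (le_trans (ltW ft) tT).
have [|m] := @le_seq_max [seq f <- s | f < t] f0; first by rewrite mem f0t.
rewrite mem => /andP[mt mfetch] mmax; exists m; split => //.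
  by rewrite sE (le_trans (ltW mt) tT).
rewrite /elapsed; congr (_ - _); apply/eqP; rewrite eq_le; apply/andP; split.
  by apply: ge_sup; [exists m|move=> x [xt xf]; apply: mmax; rewrite mem xt].
by apply: ub_le_sup => //; exists m => x [xt xf]; apply: mmax; rewrite mem xt.
Qed.

End PolicyState.

Section ItemFunctionals.
Context (R : realType) (N : nat).
Implicit Types (h : history R N) (n : 'I_N).
Local Notation leb := (@lebesgue_measure R).

(** The share of the item n in the total cost, with its parameters abstracted:
    the costs of a fetch and of a unit of age. *)
Definition item_cost (pi : policy R N) n (fee aging T : R) h : \bar R :=
  (fee%:E * nfetch pi h T n
   + \sum_(r <- h | r.2 == n) (if fetch_at pi h r.1 n then 0
                     else aging * elapsed pi h r.1 n)%:E)%E.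

Definition item_storage (pi : policy R N) n (T : R) h : \bar R :=
  (\int[leb]_(t in `[0%R, T]) (stored pi h t n)%:R%:E)%E.

Lemma possible_history_gt0 h r : possible_history h -> r \in h -> 0 < r.1.
Proof.
rewrite /possible_history => hP rh.
have /allP := order_path_min lt_trans hP.
by apply; exact: map_f.
Qed.

Lemma item_cost_ge0 pi n fee aging T h :
  0 <= fee -> 0 <= aging -> possible_history h ->
  (0 <= item_cost pi n fee aging T h)%E.
Proof.
move=> fee0 aging0 hP; apply: adde_ge0.
  by rewrite mule_ge0 ?lee_fin//; exact: esum_ge0.
rewrite big_seq_cond; apply: sume_ge0 => r /andP[rh _].
rewrite lee_fin; case: ifP => // _; rewrite mulr_ge0// elapsed_ge0//.
exact/ltW/(possible_history_gt0 hP).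
Qed.

Lemma item_storage_ge0 pi n T h : (0 <= item_storage pi n T h)%E.
Proof. by apply: integral_ge0 => t _; rewrite lee_fin. Qed.

Section Measurability.
Variables (pi : policy R N) (mpi : measurable_policy pi) (n : 'I_N).

Let measurable_if_process (b : history R N -> R -> bool) (f g : R -> R) :
  (forall k (m : k.-tuple 'I_N), measurable_fun (possible_times m `*` setT)
     (fun z : k.-tuple R * R => b (zip z.1 m) z.2)) ->
  measurable_fun setT f -> measurable_fun setT g ->
  measurable_process (fun h t => (if b h t then f (elapsed pi h t n)
                                 else g (elapsed pi h t n))%:E).
Proof.
move=> mb mf mg k m; apply/measurable_EFinP.
have [_ _ mel _] := mpi m n.
have mD : measurable (@possible_times R N k m `*` [set: R]).
  by apply: measurableX => //; exact: measurable_possible_times.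
have mfe (f' : R -> R) : measurable_fun setT f' ->
    measurable_fun (possible_times m `*` setT)
      (fun z : k.-tuple R * R => f' (elapsed pi (zip z.1 m) z.2 n)).
  move=> mf'; apply: (measurable_comp (F := setT)) => //.
apply: measurable_fun_if => //.
- exact: mb.
- by apply: measurable_funS (mfe _ mf).
- by apply: measurable_funS (mfe _ mg).
Qed.

Lemma measurable_stored_process (f g : R -> R) :
  measurable_fun setT f -> measurable_fun setT g ->
  measurable_process (fun h t => (if stored pi h t n then f (elapsed pi h t n)
                                 else g (elapsed pi h t n))%:E).
Proof.
by apply: measurable_if_process => k m; have [] := mpi m n.
Qed.

Lemma measurable_fetch_process (f g : R -> R) :
  measurable_fun setT f -> measurable_fun setT g ->
  measurable_process (fun h t => (if fetch_at pi h t n then f (elapsed pi h t n)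
                                 else g (elapsed pi h t n))%:E).
Proof.
by apply: measurable_if_process => k m; have [] := mpi m n.
Qed.

Lemma measurable_storage_process :
  measurable_process (fun h t => ((stored pi h t n)%:R : R)%:E).
Proof.
rewrite (_ : (fun _ _ => _) = (fun h t => (if stored pi h t n then cst 1 (elapsed pi h t n)
                                 else cst 0 (elapsed pi h t n))%:E)).
  exact: measurable_stored_process.
by apply/funext => h; apply/funext => t; case: stored.
Qed.

Lemma measurable_item_storage T :
  measurable_functional (item_storage pi n T).
Proof.
apply: (@measurable_functional_integral _ _ (fun h t => (stored pi h t n)%:R%:E)).
  exact: measurable_storage_process.
by move=> h t; rewrite lee_fin.
Qed.

Lemma measurable_item_cost fee aging T :
  measurable_functional (item_cost pi n fee aging T).
Proof.
move=> k m; apply: emeasurable_funD.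
  by apply: emeasurable_funM => //; have [_ _ _] := mpi m n; apply.
pose psi h t : \bar R := (if fetch_at pi h t n then 0 else aging * elapsed pi h t n)%:E.
apply: (@measurable_functional_sum _ _ psi).
apply: (@measurable_fetch_process (cst 0) (fun x => aging * x)) => //.
exact: mulrl_measurable.
Qed.

End Measurability.
End ItemFunctionals.

(** * Integrals over storage windows *)

Section Windows.
Context (R : realType).
Local Notation leb := (@lebesgue_measure R).

Lemma integral_affine (u v c : R) : 0 <= c ->
  (\int[leb]_(x in `[0%R, c]) (u + v * x)%:E = (u * c + v * c ^+ 2 / 2)%:E)%E.
Proof.
rewrite le_eqVlt => /predU1P[<-|c0].
  by rewrite set_itv1 integral_set1; congr EFin; ring.
pose F (x : R) : R := u * x + v * x ^+ 2 / 2.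
have dF (x : R) : is_derive x 1 F (u + v * x).
  apply: is_derive_eq; rewrite /GRing.scale/=; lra.
rewrite (@continuous_FTC2 _ _ F)//.
- by rewrite /F -EFinB; congr EFin; ring.
- apply: continuous_subspaceT => x.
  by apply: cvgD; [exact: cvg_cst|apply: cvgM; [exact: cvg_cst|exact: cvg_id]].
- have cF : continuous F.
    by move=> x; apply: differentiable_continuous; apply/derivable1_diffP; exact: ex_derive.
  split.
  + by move=> x _; exact: ex_derive.
  + exact/cvg_at_right_filter/cF.
  + exact/cvg_at_left_filter/cF.
- by move=> x _; rewrite derive1E derive_val.
Qed.

Lemma integral_cst_horizon (u T : R) : 0 <= T ->
  (\int[leb]_(x in `[0%R, T]) u%:E = (u * T)%:E)%E.
Proof.
move=> T0; transitivity (\int[leb]_(x in `[0%R, T]) (u + 0 * x)%:E)%E.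
  by apply: eq_integral => x _; rewrite mul0r addr0.
by rewrite integral_affine// mul0r mul0r addr0.
Qed.

Definition window (tau : R) (g : R -> R) (f t : R) : R :=
  if f < t <= f + tau then g (t - f) else 0.

Lemma measurable_window tau (g : R -> R) f :
  measurable_fun setT g -> measurable_fun setT (window tau g f).
Proof.
move=> mg; apply: measurable_fun_ifT => //.
  by apply: measurable_and; [exact: measurable_fun_ltr|exact: measurable_fun_ler].
by apply: measurableT_comp => //; exact: measurable_funB.
Qed.

Lemma window_ge0 tau (g : R -> R) f t : (forall x, 0 <= g x) ->
  0 <= window tau g f t.
Proof. by move=> g0; rewrite /window; case: ifP. Qed.

Let integral_whole_window tau (g : R -> R) f :
  measurable_fun setT g -> (forall x, 0 <= g x) ->
  (\int[leb]_(t in `]f, (f + tau)%R]) (window tau g f t)%:E =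
   \int[leb]_(x in `[0%R, tau]) (g x)%:E)%E.
Proof.
move=> mg g0.
transitivity (\int[leb]_(t in `]f, (f + tau)%R]) (g (t - f))%:E)%E.
  apply: eq_integral => t /set_mem /=; rewrite in_itv/= => ft.
  by rewrite /window ft.
rewrite -(integral_shift f tau (f := fun t => (g (t - f))%:E)).
- by apply: eq_integral => x _; rewrite addrAC subrr add0r.
- by apply/measurable_EFinP; apply: measurableT_comp => //; exact: measurable_funB.
- by move=> x; rewrite lee_fin.
Qed.

Lemma integral_window_le tau (g : R -> R) f (J : interval R) :
  measurable_fun setT g -> (forall x, 0 <= g x) ->
  (\int[leb]_(t in [set` J]) (window tau g f t)%:E <=
   \int[leb]_(x in `[0%R, tau]) (g x)%:E)%E.
Proof.
move=> mg g0; rewrite -(integral_whole_window tau f)//.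
rewrite [leLHS]integral_mkcond [leRHS]integral_mkcond.
have mw : measurable_fun setT (fun t => (window tau g f t)%:E).
  by apply/measurable_EFinP; exact: measurable_window.
have mwJ (K : interval R) : measurable_fun setT
    ((fun t => (window tau g f t)%:E) \_ [set` K]).
  apply: (measurable_restrictT _ _).1 => //; exact: measurable_funTS.
apply: ge0_le_integral => //.
- by move=> t _; apply: erestrict_ge0 => x _; rewrite lee_fin window_ge0.
- exact: mwJ.
- exact: mwJ.
- move=> t _; rewrite !patchE; case: ifP => _; last first.
    by case: ifP => // _; rewrite lee_fin window_ge0.
  by rewrite mem_setE in_itv/= /window; case: ifP.
Qed.

Lemma integral_window tau (g : R -> R) f T :
  measurable_fun setT g -> (forall x, 0 <= g x) -> 0 <= f -> f + tau <= T ->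
  (\int[leb]_(t in `[0%R, T]) (window tau g f t)%:E =
   \int[leb]_(x in `[0%R, tau]) (g x)%:E)%E.
Proof.
move=> mg g0 f0 fT; rewrite -(integral_whole_window tau f)//.
rewrite [LHS]integral_mkcond [RHS]integral_mkcond; apply: eq_integral => t _.
rewrite !patchE !mem_setE !in_itv/= /window.
case: ifP => [_|]; first by case: ifP.
case: ifP => // /andP[ft tf] /negP[]; apply/andP; split; lra.
Qed.

End Windows.

(** * A lower bound for the cost of one item *)

Section LowerBound.
Context (R : realType) (N : nat).
Implicit Types (h : history R N).
Local Notation leb := (@lebesgue_measure R).
Variables (pi : policy R N) (n : 'I_N) (rate fee aging hold tau gain : R).
Hypotheses (pi_adm : admissible pi).
Hypotheses (rate_gt0 : 0 < rate) (fee_gt0 : 0 < fee) (aging_gt0 : 0 < aging)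
  (hold_ge0 : 0 <= hold) (tau_ge0 : 0 <= tau).
Hypotheses (gain_ge : aging * tau <= gain)
  (gain_le : rate * gain <= hold + rate * aging * tau)
  (feeE : fee = gain + rate * aging * tau ^+ 2 / 2).

(** Without a copy the price is at most [fee], because a fetch also brings a copy
    for the later requests. The cap tau on the age keeps the price of a copy
    from exceeding [gain], by [gain_ge]. *)
Definition request_price h t : R :=
  if stored pi h t n then aging * Num.min (elapsed pi h t n) tau else gain.

Let gain_ge0 : 0 <= gain.
Proof. by apply: le_trans gain_ge; rewrite mulr_ge0// ltW. Qed.

Lemma request_price_ge0 h t : 0 <= request_price h t.
Proof.
rewrite /request_price; case: ifP => // st.
rewrite mulr_ge0 ?(ltW aging_gt0)// le_min tau_ge0 andbT elapsed_ge0//.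
exact/ltW/(stored_gt0 st).
Qed.

Lemma request_price_le h t : request_price h t <= gain.
Proof.
rewrite /request_price; case: ifP => // _; apply: le_trans gain_ge.
by rewrite ler_pM2l// ge_min lexx orbT.
Qed.

Let measurable_cutoff : measurable_fun setT (fun x : R => aging * Num.min x tau).
Proof.
apply: measurable_funM => //; exact: measurable_minr.
Qed.

Lemma measurable_request_price :
  measurable_process (fun h t => (request_price h t)%:E).
Proof.
have [mpi _] := pi_adm.
exact: (measurable_stored_process mpi n measurable_cutoff (measurable_cst gain)).
Qed.

Lemma predictable_request_price :
  predictable (fun h t => (request_price h t)%:E).
Proof.
move=> h t; rewrite /request_price.
by rewrite [in LHS](predictable_stored pi n h t) [in LHS](predictable_elapsed pi n h t).
Qed.

(** At the rate of the requests, what the price of a copy of age x lacks before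
    it reaches its cap. *)
Let slack (x : R) : R := rate * aging * Num.max (tau - x) 0.

Let slack_ge0 x : 0 <= slack x.
Proof. by rewrite !mulr_ge0 ?(ltW rate_gt0) ?(ltW aging_gt0)// le_max lexx orbT. Qed.

Let measurable_slack : measurable_fun setT slack.
Proof.
apply: measurable_funM => //; apply: measurable_maxr => //; exact: measurable_funB.
Qed.

Let integral_slack :
  (\int[leb]_(x in `[0%R, tau]) (slack x)%:E = (rate * aging * tau ^+ 2 / 2)%:E)%E.
Proof.
transitivity (\int[leb]_(x in `[0%R, tau])
    (rate * aging * tau + - (rate * aging) * x)%:E)%E.
  apply: eq_integral => x /set_mem /=; rewrite in_itv/= => /andP[_ xt].
  by rewrite /slack max_l ?subr_ge0//; congr EFin; ring.
by rewrite integral_affine//; congr EFin; field.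
Qed.

(** Without a copy the price alone is [gain]; with a copy of age x,
    [gain_le] compares [rate * gain] with the capped price, and the window started
    by its fetch supplies the difference [slack x]. *)
Let price_storage_slack h T (s : seq R) t :
  (forall f, f \in s = (f <= T) && fetch_at pi h f n) -> t <= T ->
  rate * gain <= hold * (stored pi h t n)%:R + rate * request_price h t
                 + \sum_(f <- s) window tau slack f t.
Proof.
move=> sE tT.
have w0 f : 0 <= window tau slack f t by exact: window_ge0.
rewrite /request_price; case: ifPn => [st|_]; last first.
  by rewrite mulr0 add0r lerDl sumr_ge0.
have [f [fs ft el]] := stored_last_fetch sE tT st.
rewrite mulr1 el.
have [le_tau|gt_tau] := leP (t - f) tau.
  have wf : window tau slack f t = rate * aging * (tau - (t - f)).
    by rewrite /window ft -lerBlDl le_tau /= /slack max_l ?subr_ge0.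
  have : window tau slack f t <= \sum_(f <- s) window tau slack f t.
    by rewrite (big_rem f)//= lerDl sumr_ge0.
  rewrite wf => hw; apply: (le_trans gain_le); apply: le_trans (lerD (lexx _) hw).
  by rewrite le_eqVlt; apply/orP; left; apply/eqP; ring.
apply: (le_trans gain_le); apply: ler_wpDr; first exact: sumr_ge0.
by rewrite mulrA.
Qed.

(** The two halves of the argument: [arrivals] bounds the prices of the requests by
    the cost, and [storage] integrates [price_storage_slack] over [0, T]. The
    constants fit since a fetch costs [gain], for the request that it may serve,
    plus the integral of its slack. *)
Lemma item_cost_lower_bound h T : possible_history h ->
  (forall r, r \in h -> r.1 <= T) -> 0 <= T ->
  ((T * (rate * gain))%:E + \sum_(r <- h | r.2 == n) (request_price h r.1)%:E <=
   item_cost pi n fee aging T h + hold%:E * item_storage pi n T h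
   + rate%:E * \int[leb]_(t in `[0%R, T]) (request_price h t)%:E)%E.
Proof.
move=> hP hT T0; have [mpi adm] := pi_adm.
have stor0 := item_storage_ge0 pi n T h.
have price0 : (0 <= \int[leb]_(t in `[0%R, T]) (request_price h t)%:E)%E.
  by apply: integral_ge0 => t _; rewrite lee_fin request_price_ge0.
have [nfoo|[s [us sE nfE]]] := nfetchP pi h T n.
  rewrite /item_cost nfoo gt0_muley ?lte_fin//.
  have neqNy (x : \bar R) : (0 <= x)%E -> x != -oo%E.
    by move=> x0; rewrite gt_eqF// (lt_le_trans _ x0).
  apply: le_trans (leey _) _; rewrite -addeA sumEFin.
  by rewrite addye// neqNy// adde_ge0// mule_ge0 ?lee_fin// ltW.
set late := (\sum_(r <- h | r.2 == n) (if fetch_at pi h r.1 n then 0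
                     else aging * elapsed pi h r.1 n)).
have arrivals : \sum_(r <- h | r.2 == n) request_price h r.1 <=
    gain * (size s)%:R + late.
  have served : \sum_(r <- h | (r.2 == n) && fetch_at pi h r.1 n) (1 : R) <= (size s)%:R.
    by have := served_fetches_le pi n hP hT; rewrite nfE lee_fin.
  apply: le_trans (lerD (ler_wpM2l gain_ge0 served) (lexx late)).
  rewrite mulr_sumr big_mkcondr -big_split/= big_seq_cond [leRHS]big_seq_cond.
  apply: ler_sum => -[t m] /andP[rh /= /eqP mn]; rewrite mn in rh *.
  case: ifPn => fetch; first by rewrite addr0 mulr1 request_price_le.
  rewrite add0r /request_price ifT; first by rewrite ler_pM2l// ge_min lexx.
  by apply/negPn/negP => /(adm _ _ _ hP rh); rewrite (negbTE fetch).
have mwin f : measurable_fun setT (window tau slack f) by exact: measurable_window.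
have mst := measurable_process_section (measurable_storage_process mpi n) hP.
have mpr := measurable_process_section measurable_request_price hP.
have mwE f : measurable_fun setT (fun t => (window tau slack f t)%:E).
  by apply/measurable_EFinP; exact: mwin.
have mstE : measurable_fun setT (fun t => hold%:E * (stored pi h t n)%:R%:E)%E.
  exact: emeasurable_funM.
have mprE : measurable_fun setT (fun t => rate%:E * (request_price h t)%:E)%E.
  exact: emeasurable_funM.
have mD := emeasurable_funD mstE mprE.
have mS : measurable_fun setT (fun t => \sum_(f <- s) (window tau slack f t)%:E)%E.
  by apply: emeasurable_sum.
have storage : ((T * (rate * gain))%:E <= hold%:E * item_storage pi n T h
   + rate%:E * (\int[leb]_(t in `[0%R, T]) (request_price h t)%:E)
   + ((size s)%:R * (rate * aging * tau ^+ 2 / 2))%:E)%E.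
  apply: (@le_trans _ _ (\int[leb]_(t in `[0%R, T])
     (hold%:E * (stored pi h t n)%:R%:E + rate%:E * (request_price h t)%:E
      + \sum_(f <- s) (window tau slack f t)%:E))%E).
    rewrite (_ : (T * _)%:E = \int[leb]_(t in `[0%R, T]) (rate * gain)%:E)%E.
      apply: ge0_le_integral => //.
      - by move=> t _; rewrite lee_fin mulr_ge0// ltW.
      - exact: measurable_funTS (emeasurable_funD mD mS).
      - move=> t /=; rewrite in_itv/= => /andP[_ tT].
        rewrite sumEFin -!EFinM -!EFinD lee_fin; exact: price_storage_slack.
    by rewrite integral_cst_horizon// mulrC.
  rewrite ge0_integralD//; first last.
  - exact: measurable_funTS mS.
  - by move=> t _; apply: sume_ge0 => f _; rewrite lee_fin window_ge0.
  - exact: measurable_funTS mD.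
  - by move=> t _; rewrite -!EFinM -EFinD lee_fin addr_ge0// mulr_ge0// ?request_price_ge0// ltW.
  rewrite ge0_integralD//; first last.
  - exact: measurable_funTS mprE.
  - by move=> t _; rewrite -EFinM lee_fin mulr_ge0 ?request_price_ge0// ltW.
  - exact: measurable_funTS mstE.
  - by move=> t _; rewrite -EFinM lee_fin mulr_ge0.
  rewrite !ge0_integralZl//;
    try (by apply: measurable_funTS);
    try (by move=> t _; rewrite lee_fin ?request_price_ge0);
    try (by rewrite lee_fin ltW).
  apply: leeD => //.
  rewrite ge0_integral_sum//; first last.
  - by move=> f t _; rewrite lee_fin window_ge0.
  - by move=> f; exact: measurable_funTS (mwE f).
  apply: (@le_trans _ _ (\sum_(f <- s) (rate * aging * tau ^+ 2 / 2)%:E)%E).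
    by apply: lee_sum => f _; rewrite -integral_slack; exact: integral_window_le.
  by rewrite sumEFin lee_fin big_const_seq count_predT iter_addr_0 mulr_natl.
rewrite sumEFin /item_cost nfE sumEFin -/late.
have /(leeD storage)/le_trans := arrivals : (_%:E <= _%:E)%E; apply.
rewrite le_eqVlt; apply/orP; left; apply/eqP.
set x := (hold%:E * _)%E; set y := (rate%:E * _)%E.
rewrite -[LHS]addeA -EFinD addeC -[RHS]addeA; congr (_ + _)%E.
by rewrite -EFinM -EFinD feeE; congr EFin; ring.
Qed.

End LowerBound.

Section ExpectedLowerBound.
Context (R : realType) (N : nat) (d : measure_display) (Omega : measurableType d)
  (P : probability Omega R).
Variables (X : nat -> {RV P >-> R}) (Y : nat -> Omega -> 'I_N).
Variables (beta : R) (p : 'I_N -> R).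
Hypotheses (beta_gt0 : 0 < beta) (p_gt0 : forall n, 0 < p n)
  (XY_poisson : poisson_requests beta p X Y).
Local Notation leb := (@lebesgue_measure R).

Lemma measurable_requests_functional T (Phi : history R N -> \bar R) :
  measurable_functional Phi ->
  measurable_fun setT (fun w => Phi (requests X Y T w)).
Proof.
by apply: measurable_requests => i V; exact: (measurable_item XY_poisson).
Qed.

(** The price is predictable, so that its sum over the requests has the same
    expectation as [beta * p n] times its integral: both leave the pathwise
    bound. They are bounded by a multiple of T, which makes the cancellation
    legitimate even when the cost is infinite. *)
Lemma expected_cost_lower_bound (pi : policy R N) (n : 'I_N)
    (fee aging hold tau gain T : R) :
  admissible pi -> 0 < fee -> 0 < aging -> 0 <= hold -> 0 <= tau ->
  aging * tau <= gain ->
  beta * p n * gain <= hold + beta * p n * aging * tau ->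
  fee = gain + beta * p n * aging * tau ^+ 2 / 2 -> 0 <= T ->
  ((T * (beta * p n * gain))%:E <=
   \int[P]_w item_cost pi n fee aging T (requests X Y T w) +
   hold%:E * \int[P]_w item_storage pi n T (requests X Y T w))%E.
Proof.
move=> pi_adm fee_gt0 aging_gt0 hold_ge0 tau_ge0 gain_ge gain_le feeE T0.
have rate_gt0 : 0 < beta * p n by exact: mulr_gt0.
have [mpi _] := pi_adm.
pose price := request_price pi n aging tau gain.
have mprice : measurable_process (fun h t => (price h t)%:E).
  exact: measurable_request_price.
have price_ge0 h t : 0 <= price h t by exact: request_price_ge0.
have price_le h t : price h t <= gain by exact: request_price_le.
have gain_ge0 : 0 <= gain by exact: le_trans (price_ge0 [::] 0) (price_le _ _).
pose A h : \bar R := (\sum_(r <- h | r.2 == n) (price h r.1)%:E)%E.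
pose I h : \bar R := (\int[leb]_(t in `[0%R, T]) (price h t)%:E)%E.
have mA := measurable_requests_functional T (measurable_functional_sum n mprice).
have mI := measurable_requests_functional T (measurable_functional_integral `[0, T] mprice
  (fun h t => price_ge0 h t : (0 <= (price h t)%:E)%E)).
have mC := measurable_requests_functional T (measurable_item_cost mpi n fee aging T).
have mS := measurable_requests_functional T (measurable_item_storage mpi n T).
have A0 h : (0 <= A h)%E by apply: sume_ge0 => r _; rewrite lee_fin.
have I0 h : (0 <= I h)%E by apply: integral_ge0 => t _; rewrite lee_fin.
have C0 w : (0 <= item_cost pi n fee aging T (requests X Y T w))%E.
  by apply: item_cost_ge0; [exact: ltW|exact: ltW|exact: possible_requests].
have EA : (\int[P]_w A (requests X Y T w) =
    (beta * p n)%:E * \int[P]_w I (requests X Y T w))%E.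
  apply: (expected_sum_over_requests beta_gt0 p_gt0 XY_poisson n T mprice).
    by move=> h t; rewrite lee_fin.
  exact: predictable_request_price.
have intP (u : R) : (\int[P]_w u%:E = u%:E)%E.
  by rewrite integral_cst//= probability_setT mule1.
have EI : ((beta * p n)%:E * \int[P]_w I (requests X Y T w))%E \is a fin_num.
  have I_le w : (I (requests X Y T w) <= (gain * T)%:E)%E.
    apply: (@le_trans _ _ (\int[leb]_(t in `[0%R, T]) gain%:E)%E).
      apply: ge0_le_integral => //.
      - by move=> t _; rewrite lee_fin.
      - exact: measurable_funTS (measurable_process_section mprice (possible_requests _ _ _ _)).
      - by move=> t _; rewrite lee_fin.
    by rewrite integral_cst_horizon.
  rewrite fin_numM// ge0_fin_numE; last by apply: integral_ge0 => w _; exact: I0.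
  apply: (@le_lt_trans _ _ (\int[P]_w (gain * T)%:E)%E).
    by apply: ge0_le_integral => // w _; rewrite lee_fin mulr_ge0.
  by rewrite intP ltry.
have : (\int[P]_w ((T * (beta * p n * gain))%:E + A (requests X Y T w)) <=
  \int[P]_w (item_cost pi n fee aging T (requests X Y T w)
             + hold%:E * item_storage pi n T (requests X Y T w)
             + (beta * p n)%:E * I (requests X Y T w)))%E.
  apply: ge0_le_integral => //.
  - by move=> w _; rewrite adde_ge0// lee_fin !mulr_ge0// ltW.
  - exact: emeasurable_funD.
  - by apply: emeasurable_funD; [apply: emeasurable_funD => //|]; exact: emeasurable_funM.
  - move=> w _; apply: item_cost_lower_bound => //.
      exact: possible_requests.
    by move=> r; exact: requests_le.
have hold_E : (0 <= hold%:E)%E by rewrite lee_fin.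
have rate_E : (0 <= (beta * p n)%:E)%E by rewrite lee_fin ltW.
have S0 w : (0 <= hold%:E * item_storage pi n T (requests X Y T w))%E.
  by rewrite mule_ge0// item_storage_ge0.
have mhS : measurable_fun setT
    (fun w => hold%:E * item_storage pi n T (requests X Y T w))%E.
  exact: emeasurable_funM.
rewrite ge0_integralD//; last by move=> w _; rewrite lee_fin !mulr_ge0// ltW.
rewrite intP.
rewrite [leRHS]ge0_integralD//; first last.
- exact: emeasurable_funM.
- by move=> w _; rewrite mule_ge0.
- exact: emeasurable_funD.
- by move=> w _; rewrite adde_ge0.
rewrite ge0_integralD// !ge0_integralZl//; last by move=> w _; exact: item_storage_ge0.
by rewrite EA leeD2rE.
Qed.

End ExpectedLowerBound.

(** * The fetches of a timer policy *)

Section TimerFetches.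
Context (R : realType) (N : nat) (tau : 'I_N -> R) (n : 'I_N).
Hypothesis tau_ge0 : 0 <= tau n.
Implicit Types (h : history R N) (s : seq R).

(** The times of all the fetches, oldest first. The last fetch alone drives the
    policy, but comparing a request with every earlier fetch is the same, and
    gives access to the order and spacing of the list. *)
Definition timer_fetches h : seq R :=
  foldl (fun s r => if (r.2 == n) && all (fun f => f + tau n < r.1) s
                    then rcons s r.1 else s) [::] h.

Lemma timer_fetches_rcons h r : timer_fetches (rcons h r) =
  if (r.2 == n) && all (fun f => f + tau n < r.1) (timer_fetches h)
  then rcons (timer_fetches h) r.1 else timer_fetches h.
Proof. by rewrite /timer_fetches foldl_rcons. Qed.

Lemma possible_history_rcons h r : possible_history (rcons h r) ->
  [/\ possible_history h, 0 < r.1 & forall r', r' \in h -> r'.1 < r.1].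
Proof.
rewrite /possible_history !(path_pairwise lt_trans) /unzip1 map_rcons -rcons_cons.
rewrite pairwise_rcons => /andP[/= /andP[r0 /allP hr] hP]; split => //.
by move=> r' r'h; apply: hr; exact: map_f.
Qed.

Lemma timer_fetches_mem h f : f \in timer_fetches h -> (f, n) \in h.
Proof.
elim/last_ind: h => // h r IHh; rewrite timer_fetches_rcons mem_rcons inE.
case: ifPn => [/andP[/eqP rn _]|_ /IHh ->]; last by rewrite orbT.
rewrite mem_rcons inE => /predU1P[->|/IHh ->]; last by rewrite orbT.
by case: r rn => t m /= ->; rewrite eqxx.
Qed.

Lemma timer_fetches_pairwise h :
  pairwise (fun x y => x + tau n < y) (timer_fetches h).
Proof.
elim/last_ind: h => // h r IHh; rewrite timer_fetches_rcons.
by case: ifPn => // /andP[_ hr]; rewrite pairwise_rcons hr.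
Qed.

Lemma timer_fetches_uniq h : uniq (timer_fetches h).
Proof.
apply: pairwise_uniq (timer_fetches_pairwise h) => x.
by rewrite ltNge lerDl tau_ge0.
Qed.

Lemma timer_fetches_spaced h f g :
  f \in timer_fetches h -> g \in timer_fetches h -> f < g -> f + tau n < g.
Proof.
have := timer_fetches_pairwise h.
elim: (timer_fetches h) => //= x s IHs /andP[/allP xs sP].
rewrite !inE => /predU1P[->|fs] /predU1P[->|gs] fg.
- by rewrite ltxx in fg.
- exact: xs.
- by have := xs _ fs => xf; lra.
- exact: IHs.
Qed.

Lemma timer_last_fetchP h :
  if timer_last_fetch tau h n is Some f
  then f \in timer_fetches h /\ forall g, g \in timer_fetches h -> g <= f
  else timer_fetches h = [::].
Proof.
elim/last_ind: h => // h r; rewrite /timer_last_fetch foldl_rcons timer_fetches_rcons.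
rewrite -/(timer_last_fetch tau h n); case: (r.2 =P n) => /= [_|_]; last by [].
case: timer_last_fetch => [f [fh fmax]|-> /=]; last first.
  by rewrite mem_head; split => // g; rewrite inE => /eqP ->.
have [rf|fr] := leP r.1 (f + tau n).
  case: allP => // /(_ f fh); by rewrite ltNge rf.
case: allP => [_|[]]; last by move=> g /fmax gf; apply: le_lt_trans fr; rewrite lerD2r.
rewrite mem_rcons mem_head; split => // g; rewrite mem_rcons inE => /predU1P[->//|/fmax gf].
by apply: le_trans (ltW fr); rewrite ler_wpDr.
Qed.

(** Causality: a later request never changes the earlier fetches. *)
Lemma timer_fetches_upto h t : possible_history h ->
  timer_fetches (upto h t) = [seq f <- timer_fetches h | f <= t].
Proof.
elim/last_ind: h => // h r IHh /possible_history_rcons[hP _ hr].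
rewrite /upto filter_rcons -/(upto h t); have [rt|tr] := leP r.1 t.
  have -> : upto h t = h.
    by apply/all_filterP/allP => r' /hr /ltW r'r; exact: le_trans rt.
  symmetry; apply/all_filterP/allP => f /timer_fetches_mem.
  rewrite mem_rcons inE => /predU1P[E|/hr/ltW fr]; last exact: le_trans rt.
  by move: rt; rewrite -E.
rewrite IHh// timer_fetches_rcons; case: ifP => // _.
by rewrite filter_rcons leNgt tr.
Qed.

Lemma timer_fetches_gt0 h f : possible_history h ->
  f \in timer_fetches h -> 0 < f.
Proof. by move=> hP /timer_fetches_mem/(possible_history_gt0 hP). Qed.

Lemma timer_lastP h t : possible_history h ->
  if timer_last_fetch tau (upto h t) n is Some f
  then [/\ f \in timer_fetches h, f <= t &
        forall g, g \in timer_fetches h -> g <= t -> g <= f]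
  else forall g, g \in timer_fetches h -> t < g.
Proof.
move=> hP; have := timer_last_fetchP (upto h t); rewrite timer_fetches_upto//.
case: timer_last_fetch => [f|s0 g gh].
  rewrite mem_filter => -[/andP[ft fh] fmax]; split => // g gh gt.
  by apply: fmax; rewrite mem_filter gt.
by rewrite ltNge; apply/negP => gt; have := in_nil g; rewrite -s0 mem_filter gt gh.
Qed.

Let pi := timer_policy tau.

Lemma timer_fetch_at h t : possible_history h ->
  fetch_at pi h t n = (t \in timer_fetches h).
Proof.
move=> hP; rewrite /fetch_at /=; have := timer_lastP t hP.
case: timer_last_fetch => [f [fh ft fmax]|none]; last first.
  rewrite andbF; apply/esym/negbTE/negP => /none; by rewrite ltxx.
apply/andP/idP => [[_ /eqP[<-]]//|th].
split; first exact/ltW/(timer_fetches_gt0 hP th).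
by apply/eqP; congr Some; apply/eqP; rewrite eq_le ft fmax.
Qed.

(** A copy fetched at f is kept exactly during [f < t <= f + tau n]: the eviction
    time is reached before the next fetch, which comes after the timer expires. *)
Lemma timer_storedP h t : possible_history h ->
  reflect (exists f, [/\ f \in timer_fetches h, f < t & t <= f + tau n])
    (stored pi h t n).
Proof.
move=> hP; apply: (iffP (asboolP _)).
  move=> [f [ft]]; rewrite timer_fetch_at// => fh keep.
  have [|g] := @le_seq_max _ [seq g <- timer_fetches h | g < t] f.
    by rewrite mem_filter ft.
  rewrite mem_filter => /andP[gt gh] gmax; exists g; split => //.
  have fg : f <= g by apply: gmax; rewrite mem_filter ft.
  rewrite leNgt; apply/negP => gtt.
  have := keep (g + tau n); rewrite gtt (le_trans fg) ?lerDl//.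
  move=> /(_ isT) /negP; apply; rewrite /evict_at /=.
  have := timer_lastP (g + tau n) hP.
  case: timer_last_fetch => [g' [g'h g't g'max]|/(_ g gh)]; last by rewrite ltNge lerDl tau_ge0.
  by rewrite lerD2r; apply: gmax; rewrite mem_filter g'h andbT (le_lt_trans g't).
move=> [f [fh ft tf]]; exists f; split; [by []|by rewrite timer_fetch_at|].
move=> s /andP[fs st]; rewrite /evict_at /=.
have := timer_lastP s hP; case: timer_last_fetch => [g [gh gs gmax]|//].
rewrite -ltNge; apply: (lt_le_trans st); apply: (le_trans tf).
by rewrite lerD2r; exact: gmax.
Qed.

Lemma timer_elapsed h t f : possible_history h ->
  f \in timer_fetches h -> f < t -> t <= f + tau n -> elapsed pi h t n = t - f.
Proof.
move=> hP fh ft tf; rewrite /elapsed; congr (_ - _).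
apply/eqP; rewrite eq_le; apply/andP; split.
  apply: ge_sup; first by exists f; split => //; rewrite timer_fetch_at.
  move=> g [gt]; rewrite timer_fetch_at// => gh; rewrite leNgt; apply/negP.
  by move=> /(timer_fetches_spaced fh gh); rewrite ltNge (le_trans (ltW gt)).
apply: ub_le_sup; last by split => //; rewrite timer_fetch_at.
by exists t => g [/ltW].
Qed.

(** This is where the two descriptions of the rule meet: a request starts a timer
    if and only if it does not fall in a storage period. *)
Lemma timer_fetchesVstored h t : possible_history h -> (t, n) \in h ->
  (t \in timer_fetches h) = ~~ stored pi h t n.
Proof.
move=> hP th; apply/idP/idP => [tf|].
  apply/negP => /(timer_storedP _ hP)[f [fh ft tfn]].
  by have := timer_fetches_spaced fh tf ft; rewrite ltNge tfn.
apply: contraR => tn; apply/timer_storedP => //.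
elim/last_ind: h hP th tn => // h [rt rn] IHh /possible_history_rcons[hP _ hr].
rewrite mem_rcons inE timer_fetches_rcons /=.
set G := (if _ then _ else _).
have sub (f : R) : f \in timer_fetches h -> f \in G.
  by move=> fh; rewrite /G; case: ifP => // _; rewrite mem_rcons inE fh orbT.
move=> /predU1P[[tE nE]|th tn].
  rewrite -tE -nE eqxx /= in G sub hr *; rewrite {}/G in sub *.
  case: ifPn => [_|/allPn[f fh]]; first by rewrite mem_rcons mem_head.
  rewrite -leNgt => tf _; exists f; split => //.
  exact: (hr _ (timer_fetches_mem fh)).
have [|f [fh ft tf]] := IHh hP th; first by apply: contra tn; exact: sub.
by exists f; split => //; exact: sub.
Qed.

Lemma timer_admissible_item h t : possible_history h -> (t, n) \in h ->
  ~~ stored pi h t n -> fetch_at pi h t n.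
Proof. by move=> hP th; rewrite timer_fetch_at// timer_fetchesVstored. Qed.

Lemma timer_nfetch h T : possible_history h ->
  nfetch pi h T n = (size [seq f <- timer_fetches h | f <= T])%:R%:E.
Proof.
move=> hP; have [|] := nfetchP pi h T n; last first.
  move=> [s [us sE ->]]; congr (_%:R%:E); apply: perm_size; apply: uniq_perm => //.
    by rewrite filter_uniq// timer_fetches_uniq.
  by move=> f; rewrite sE timer_fetch_at// mem_filter.
rewrite /nfetch (_ : mkset _ = [set` [seq f <- timer_fetches h | f <= T]]).
  rewrite esum_fset//; last exact: finite_seq.
  rewrite -fsbig_seq ?filter_uniq ?timer_fetches_uniq//.
  by rewrite sumEFin.
by apply/seteqP; split=> f /=; rewrite timer_fetch_at// mem_filter => /andP.
Qed.

End TimerFetches.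

(** * Timer policies are admissible *)

Section TimerMeasurability.
Context (R : realType) (N : nat) (tau : 'I_N -> R) (n : 'I_N).
Hypothesis tau_ge0 : 0 <= tau n.

Variables (k : nat) (m : k.-tuple 'I_N).
Local Notation D := (@possible_times R N k m).

Let fetched i (a : k.-tuple R) : bool :=
  nth 0 a i \in timer_fetches tau n (zip a m).

Let nth_in (a : k.-tuple R) i : (i < k)%N ->
  (nth 0 a i, nth n m i) \in zip a m.
Proof.
move=> ik; rewrite -(@nth_zip _ _ 0 n a m) ?size_tuple//.
by apply: mem_nth; rewrite size_zip !size_tuple minnn.
Qed.

Let ltn_times (a : k.-tuple R) i j : D a -> (i < k)%N -> (j < k)%N ->
  (nth 0 a i < nth 0 a j) = (i < j)%N.
Proof.
rewrite possible_timesE => /= /path_sorted sa ik jk.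
by rewrite (lt_sorted_ltn_nth _ sa) ?inE ?size_tuple.
Qed.

Let fetch_times (a : k.-tuple R) f : D a -> f \in timer_fetches tau n (zip a m) ->
  exists2 i, (i < k)%N & f = nth 0 a i /\ nth n m i = n.
Proof.
move=> Da /timer_fetches_mem /(nthP (0, n))[i].
rewrite size_zip !size_tuple minnn => ik.
by rewrite nth_zip ?size_tuple// => -[<- mi]; exists i.
Qed.

(** A recursive description of the fetched requests by inequalities between
    arrival times, from which measurability follows by induction on i. *)
Let fetchedE (a : k.-tuple R) i : D a -> (i < k)%N -> fetched i a =
  (nth n m i == n) &&
  all (fun j => ~~ fetched j a || (nth 0 a j + tau n < nth 0 a i)) (iota 0 i).
Proof.
move=> Da ik; apply/idP/andP => [fi|[/eqP mi /allP spaced]].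
  have [j jk [aij mj]] := fetch_times Da fi.
  have ij : i = j.
    by have := ltn_times Da ik jk; have := ltn_times Da jk ik; rewrite aij ltxx; case: ltngtP.
  split; first by rewrite ij mj.
  apply/allP => l; rewrite mem_iota/= add0n => li; case: (boolP (fetched l a)) => //= fl.
  by apply: timer_fetches_spaced fl fi _ => //; rewrite ltn_times// (ltn_trans li).
have := nth_in a ik; rewrite mi => /(timer_fetchesVstored tau_ge0 Da) E.
rewrite /fetched E; apply/negP => /(timer_storedP tau_ge0 _ Da)[f [fh ft tf]].
have [j jk [fj mj]] := fetch_times Da fh; rewrite fj ltn_times// in ft.
have := spaced j; rewrite mem_iota add0n ft/= => /(_ isT).
by rewrite /fetched -fj fh /= ltNge tf.
Qed.

Let measurable_fetched i : (i < k)%N -> measurable_fun D (fetched i).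
Proof.
have mD : measurable D by exact: measurable_possible_times.
elim/ltn_ind: i => i IHi ik.
apply: measurable_fun_on; last by move=> a Da; exact: fetchedE.
apply: measurable_and; first exact: measurable_cst.
apply: measurable_all_seq => j; rewrite mem_iota add0n => ji.
apply: measurable_or; first by apply: measurable_neg; apply: IHi => //; exact: ltn_trans ik.
apply: measurable_fun_ltr; last by apply: measurable_funTS; exact: measurable_nth_tuple.
by apply: measurable_funD => //; apply: measurable_funTS; exact: measurable_nth_tuple.
Qed.

Let measurable_time_process i :
  measurable_fun (D `*` setT) (fun z : k.-tuple R * R => nth 0 z.1 i).
Proof.
apply: measurable_funTS.
exact: (measurableT_comp (@measurable_nth_tuple R k i) measurable_fst).
Qed.

Let measurable_fetched_process i : (i < k)%N ->
  measurable_fun (D `*` setT) (fun z : k.-tuple R * R => fetched i z.1).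
Proof.
move=> ik; apply: (measurable_comp (F := D)).
- exact: measurable_possible_times.
- by move=> _ [z [zD _] <-].
- exact: measurable_fetched.
- by apply: measurable_funTS; exact: measurable_fst.
Qed.

Let pi := timer_policy tau.

Let has_fetched (Q : R -> bool) a : D a ->
  reflect (exists2 f, f \in timer_fetches tau n (zip a m) & Q f)
    (has (fun i => fetched i a && Q (nth 0 a i)) (iota 0 k)).
Proof.
move=> Da; apply: (iffP hasP) => [[i _ /andP[fi Qi]]|[f fh Qf]].
  by exists (nth 0 a i).
have [i ik [fi _]] := fetch_times Da fh.
exists i; first by rewrite mem_iota.
by rewrite -fi Qf /fetched -fi fh.
Qed.

Let timer_fetch_atE a t : D a -> fetch_at pi (zip a m) t n =
  has (fun i => fetched i a && (nth 0 a i == t)) (iota 0 k).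
Proof.
move=> Da; rewrite (timer_fetch_at tau_ge0)//.
apply/idP/(has_fetched (fun f => f == t) Da) => [th|[f fh /eqP <-//]].
by exists t.
Qed.

Let timer_storedE a t : D a -> stored pi (zip a m) t n =
  has (fun i => fetched i a && (nth 0 a i < t <= nth 0 a i + tau n)) (iota 0 k).
Proof.
move=> Da; apply/(timer_storedP tau_ge0 _ Da)/(has_fetched (fun f => f < t <= f + tau n) Da).
  by move=> [f [fh ft tf]]; exists f => //; rewrite ft.
by move=> [f fh /andP[ft tf]]; exists f.
Qed.

(** The default 0 of the maximum is the value of [sup set0], and it is harmless
    since all arrival times are positive. *)
Let timer_elapsedE a t : D a -> elapsed pi (zip a m) t n =
  t - \big[Num.max/0]_(i <- iota 0 k)
        (if fetched i a && (nth 0 a i < t) then nth 0 a i else 0).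
Proof.
move=> Da; rewrite /elapsed; congr (_ - _); set A := mkset _.
have AE f : A f <-> f < t /\ f \in timer_fetches tau n (zip a m).
  by rewrite /A /= (timer_fetch_at tau_ge0).
have ubA : has_ubound A by exists t => f [/ltW].
have sup_ge0 : 0 <= sup A.
  have [->|/set0P[f Af]] := eqVneq A set0; first by rewrite sup0.
  apply: (le_trans _ (ub_le_sup ubA Af)).
  by move/AE : Af => [_ /(timer_fetches_gt0 Da)/ltW].
apply/eqP; rewrite eq_le; apply/andP; split.
  have [->|/set0P A0] := eqVneq A set0; first by rewrite sup0 bigmax_ge_id.
  apply: ge_sup => // f /AE[ft fh]; have [i ik [fi _]] := fetch_times Da fh.
  apply: (@le_trans _ _ (if fetched i a && (nth 0 a i < t) then nth 0 a i else 0)).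
    by rewrite -fi ft /fetched -fi fh.
  apply: (@le_bigmax_seq _ _ _ _ 0 i xpredT
    (fun i => if fetched i a && (nth 0 a i < t) then nth 0 a i else 0)) => //.
  by rewrite mem_iota.
apply: bigmax_le => // i _; case: ifPn => // /andP[fi it].
by apply: ub_le_sup => //; apply/AE.
Qed.

Let timer_nfetchE a T : D a -> nfetch pi (zip a m) T n =
  (\sum_(i < k) (if fetched i a && (nth 0 a i <= T) then 1 else 0))%:E.
Proof.
move=> Da; rewrite (timer_nfetch tau_ge0)//; congr EFin.
rewrite -(big_mkord xpredT (fun i => if fetched i a && (nth 0 a i <= T) then 1 else 0)).
rewrite /index_iota subn0.
rewrite -big_mkcond/= -big_filter big_const_seq count_predT iter_addr_0.
congr (_%:R); rewrite -(size_map (nth 0 a)); apply/perm_size/uniq_perm.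
- by rewrite filter_uniq// timer_fetches_uniq.
- rewrite map_inj_in_uniq ?filter_uniq ?iota_uniq// => i j.
  rewrite !mem_filter !mem_iota => /andP[_ ik] /andP[_ jk] ij.
  by have := ltn_times Da ik jk; have := ltn_times Da jk ik; rewrite ij ltxx; case: ltngtP.
- move=> f; rewrite mem_filter; apply/andP/mapP.
    move=> [fT fh]; have [i ik [fi _]] := fetch_times Da fh; exists i => //.
    by rewrite mem_filter mem_iota ik /fetched -fi fh fT.
  by move=> [i]; rewrite mem_filter => /andP[/andP[fi it] _] ->.
Qed.

Lemma measurable_timer_policy_item :
  [/\ measurable_fun (D `*` setT)
        (fun z : k.-tuple R * R => fetch_at pi (zip z.1 m) z.2 n),
      measurable_fun (D `*` setT)
        (fun z : k.-tuple R * R => stored pi (zip z.1 m) z.2 n),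
      measurable_fun (D `*` setT)
        (fun z : k.-tuple R * R => elapsed pi (zip z.1 m) z.2 n) &
      forall T, measurable_fun D
        (fun a : k.-tuple R => nfetch pi (zip a m) T n)].
Proof.
have mt : measurable_fun (D `*` setT) (snd : k.-tuple R * R -> R).
  by apply: measurable_funTS; exact: measurable_snd.
have mi i : (i \in iota 0 k) = (i < k)%N by rewrite mem_iota.
split.
- apply: measurable_fun_on; last by move=> z [Dz _]; exact: timer_fetch_atE.
  apply: measurable_has_seq => i; rewrite mi => ik.
  apply: measurable_and; first exact: measurable_fetched_process.
  exact: measurable_fun_eqr.
- apply: measurable_fun_on; last by move=> z [Dz _]; exact: timer_storedE.
  apply: measurable_has_seq => i; rewrite mi => ik.
  apply: measurable_and; first exact: measurable_fetched_process.
  apply: measurable_and; first exact: measurable_fun_ltr.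
  by apply: measurable_fun_ler => //; apply: measurable_funD.
- apply: measurable_fun_on; last by move=> z [Dz _]; exact: timer_elapsedE.
  apply: measurable_funB => //.
  have : {in iota 0 k, forall i, (i < k)%N} by move=> i; rewrite mi.
  elim: (iota 0 k) => [_|i s IHs lek].
    by under eq_fun do rewrite big_nil; exact: measurable_cst.
  under eq_fun do rewrite big_cons.
  apply: measurable_maxr; last first.
    by apply: IHs => j js; apply: lek; rewrite inE js orbT.
  have ik : (i < k)%N by apply: lek; exact: mem_head.
  apply: measurable_fun_if => //.
  + by apply: measurableX => //; exact: measurable_possible_times.
  + apply: measurable_and; first exact: measurable_fetched_process.
    exact: measurable_fun_ltr.
  + apply: measurable_funS (measurable_time_process i) => //.
    by apply: measurableX => //; exact: measurable_possible_times.
- move=> T.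
  apply: measurable_fun_on; last by move=> z Dz; exact: timer_nfetchE.
  apply/measurable_EFinP; apply: measurable_sum => i.
  apply: measurable_fun_if => //; first exact: measurable_possible_times.
  apply: measurable_and; first exact: measurable_fetched.
  by apply: measurable_fun_ler => //; apply: measurable_funTS; exact: measurable_nth_tuple.
Qed.

End TimerMeasurability.

Lemma timer_policy_admissible (R : realType) (N : nat) (tau : 'I_N -> R) :
  (forall n, 0 <= tau n) -> admissible (timer_policy tau).
Proof.
move=> tau0; split; first by move=> k m n; exact: measurable_timer_policy_item.
by move=> h t n; exact: timer_admissible_item.
Qed.

(** * Expected cost and storage under a timer policy *)

Section TimerPaths.
Context (R : realType) (N : nat) (tau : 'I_N -> R) (n : 'I_N).
Hypothesis tau_ge0 : 0 <= tau n.
Local Notation leb := (@lebesgue_measure R).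
Local Notation pi := (timer_policy tau).
Local Notation fetches := (timer_fetches tau n).
Implicit Types (h : history R N) (g : R -> R).

(** The storage periods are disjoint: at most one window is open at a time. *)
Lemma timer_stored_window g h t : possible_history h ->
  (if stored pi h t n then g (elapsed pi h t n) else 0) =
  \sum_(f <- fetches h) window (tau n) g f t.
Proof.
move=> hP; case: (timer_storedP tau_ge0 t hP) => [[f [fh ft tf]]|none].
  rewrite (bigD1_seq f)//= ?timer_fetches_uniq// {1}/window ft tf/=.
  rewrite (timer_elapsed tau_ge0 hP fh ft tf) big_seq_cond big1 ?addr0//.
  move=> f' /andP[f'h ff']; rewrite /window; case: ifP => // /andP[f't tf'].
  move: ff'; rewrite neq_lt => /orP[lt|lt].
    have := timer_fetches_spaced f'h fh lt; lra.
  have := timer_fetches_spaced fh f'h lt; lra.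
rewrite big1_seq// => f /= fh; rewrite /window; case: ifP => // /andP[ft tf].
by case: none; exists f.
Qed.

Let integral_timer_stored g h T : measurable_fun setT g -> (forall x, 0 <= g x) ->
  possible_history h ->
  (\int[leb]_(t in `[0%R, T]) (if stored pi h t n then g (elapsed pi h t n) else 0)%:E =
   \sum_(f <- fetches h) \int[leb]_(t in `[0%R, T]) (window (tau n) g f t)%:E)%E.
Proof.
move=> mg g0 hP; rewrite -ge0_integral_sum//; first last.
- by move=> f t _; rewrite lee_fin window_ge0.
- by move=> f; apply/measurable_funTS/measurable_EFinP; exact: measurable_window.
by apply: eq_integral => t _; rewrite timer_stored_window// sumEFin.
Qed.

Lemma integral_timer_stored_le g h T (c : R) :
  measurable_fun setT g -> (forall x, 0 <= g x) -> possible_history h ->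
  (\int[leb]_(x in `[0%R, tau n]) (g x)%:E = c%:E)%E ->
  (\int[leb]_(t in `[0%R, T]) (if stored pi h t n then g (elapsed pi h t n) else 0)%:E <=
   (c * (size (fetches h))%:R)%:E)%E.
Proof.
move=> mg g0 hP gc; rewrite integral_timer_stored//.
apply: (@le_trans _ _ (\sum_(f <- fetches h) c%:E)%E).
  by apply: lee_sum => f _; rewrite -gc; exact: integral_window_le.
by rewrite sumEFin big_const_seq count_predT iter_addr_0 mulr_natr.
Qed.

Let storageE h T : item_storage pi n T h =
  (\int[leb]_(t in `[0%R, T]) (if stored pi h t n then cst 1 (elapsed pi h t n) else 0)%:E)%E.
Proof. by apply: eq_integral => t _; case: stored. Qed.

Let integral_cst1 : (\int[leb]_(x in `[0%R, tau n]) (cst 1 x)%:E = (tau n)%:E)%E.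
Proof. by rewrite integral_cst_horizon// mul1r. Qed.

Lemma timer_storage_le h T : possible_history h ->
  (item_storage pi n T h <= (tau n * (size (fetches h))%:R)%:E)%E.
Proof. by move=> hP; rewrite storageE; apply: integral_timer_stored_le. Qed.

(** Only the last storage period may be cut by the horizon, because the timer of a
    fetch has expired when the next fetch takes place. *)
Lemma timer_storage_ge h T : possible_history h ->
  (forall r, r \in h -> r.1 <= T) ->
  ((tau n * (size (fetches h))%:R)%:E <= item_storage pi n T h + (tau n)%:E)%E.
Proof.
move=> hP hT; rewrite storageE integral_timer_stored//.
have fT f : f \in fetches h -> 0 <= f <= T.
  move=> fh; rewrite (ltW (timer_fetches_gt0 hP fh)).
  exact: (hT (f, n) (timer_fetches_mem fh)).
have := timer_fetches_pairwise tau n h.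
move: fT; case/lastP: (fetches h) => [_ _|s l fT].
  by rewrite big_nil mulr0 add0e lee_fin.
rewrite pairwise_rcons => /andP[/allP sl _].
rewrite size_rcons -cats1 big_cat/= big_seq_cond.
under eq_bigr => f /andP[fs _].
  rewrite integral_window//; first last.
  - have /andP[_ lT] : 0 <= l <= T by apply: fT; rewrite mem_rcons mem_head.
    exact: le_trans (ltW (sl _ fs)) lT.
  - by have /andP[] : 0 <= f <= T by apply: fT; rewrite mem_rcons inE fs orbT.
  rewrite integral_cst1; over.
rewrite -big_seq_cond sumEFin big_const_seq count_predT iter_addr_0.
rewrite -addeA addeCA -EFinD mulrS mulrDr mulr1 mulr_natr addrC.
apply: leeDr; rewrite big_seq1; apply: integral_ge0 => t _.
by rewrite lee_fin window_ge0.
Qed.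

Lemma timer_nfetchE h T : possible_history h ->
  (forall r, r \in h -> r.1 <= T) ->
  nfetch pi h T n = (size (fetches h))%:R%:E.
Proof.
move=> hP hT; rewrite timer_nfetch//; congr (_%:R%:E); congr size.
by apply/all_filterP/allP => f /timer_fetches_mem/hT.
Qed.

Lemma timer_nfetch_requests h : possible_history h ->
  (size (fetches h))%:R =
  \sum_(r <- h | r.2 == n) (~~ stored pi h r.1 n)%:R :> R.
Proof.
move=> hP; rewrite -big_filter -(big_map fst xpredT (fun t => (~~ stored pi h t n)%:R)).
set s := [seq _ | _ <- _].
transitivity (\sum_(t <- s | t \in fetches h) 1 : R); last first.
  rewrite big_mkcond !big_seq; apply: eq_bigr => t /mapP[r].
  rewrite mem_filter => /andP[/eqP rn rh] tE.
  rewrite (timer_fetchesVstored tau_ge0 hP) ?tE -?rn; last by case: (r) rh.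
  by case: stored.
rewrite -big_filter big_const_seq count_predT iter_addr_0; congr (_%:R).
apply/perm_size/uniq_perm; first exact: timer_fetches_uniq.
  apply: filter_uniq; rewrite (subseq_uniq (map_subseq _ (filter_subseq _ _)))//.
  exact: possible_history_uniq.
move=> f; rewrite mem_filter; apply/idP/andP => [fh|[]//]; split => //.
by apply/mapP; exists (f, n) => //; rewrite mem_filter eqxx (timer_fetches_mem fh).
Qed.

Lemma timer_item_cost fee aging h T : possible_history h ->
  (forall r, r \in h -> r.1 <= T) ->
  item_cost pi n fee aging T h = (fee%:E * (size (fetches h))%:R%:E +
   \sum_(r <- h | r.2 == n)
     (if stored pi h r.1 n then aging * elapsed pi h r.1 n else 0)%:E)%E.
Proof.
move=> hP hT; rewrite /item_cost timer_nfetchE//; congr (_ + _)%E.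
rewrite big_seq_cond [RHS]big_seq_cond; apply: eq_bigr => -[t m] /= /andP[rh /eqP mn].
rewrite mn in rh; rewrite timer_fetch_at// timer_fetchesVstored//.
by case: stored.
Qed.

End TimerPaths.

Section ExpectedTimer.
Context (R : realType) (N : nat) (d : measure_display) (Omega : measurableType d)
  (P : probability Omega R).
Variables (X : nat -> {RV P >-> R}) (Y : nat -> Omega -> 'I_N).
Variables (beta : R) (p tau : 'I_N -> R).
Hypotheses (beta_gt0 : 0 < beta) (p_gt0 : forall n, 0 < p n)
  (XY_poisson : poisson_requests beta p X Y).
Hypothesis tau_ge0 : forall n, 0 <= tau n.
Variables (n : 'I_N) (T : R).
Hypothesis T_ge0 : 0 <= T.
Local Notation leb := (@lebesgue_measure R).
Local Notation pi := (timer_policy tau).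
Local Notation rate := (beta * p n).
Local Notation nb_fetches w := (size (timer_fetches tau n (requests X Y T w))).

Let rate_gt0 : 0 < rate. Proof. exact: mulr_gt0. Qed.
Let mpi : measurable_policy pi := (timer_policy_admissible tau_ge0).1.
Let hP := possible_requests X Y T.
Let hT : forall w r, r \in requests X Y T w -> r.1 <= T.
Proof. by move=> w r; exact: requests_le. Qed.

Let intP (u : R) : (\int[P]_w u%:E = u%:E)%E.
Proof. by rewrite integral_cst//= probability_setT mule1. Qed.

Let F := (\int[P]_w (nb_fetches w)%:R%:E)%E.
Let O := (\int[P]_w item_storage pi n T (requests X Y T w))%E.

Let measurable_fetches : measurable_fun setT (fun w => (nb_fetches w)%:R%:E : \bar R).
Proof.
have mnf : measurable_functional (fun h => nfetch pi h T n).
  by move=> k m; have [_ _ _] := mpi m n; apply.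
apply: measurable_fun_on (measurable_requests_functional XY_poisson T mnf) _.
by move=> w _; rewrite timer_nfetchE//; exact: hT.
Qed.

Let measurable_storage : measurable_fun setT (fun w => item_storage pi n T (requests X Y T w)).
Proof.
exact: (measurable_requests_functional XY_poisson T
  (measurable_item_storage mpi n T)).
Qed.

Let storage_ge0 w : (0 <= item_storage pi n T (requests X Y T w))%E.
Proof. exact: item_storage_ge0. Qed.

Let storage_le : (O <= (tau n)%:E * F)%E.
Proof.
rewrite -ge0_integralZl//; last by rewrite lee_fin.
apply: ge0_le_integral => //; first exact: emeasurable_funM.
by move=> w _; rewrite -EFinM; exact: timer_storage_le.
Qed.

Let storage_ge : ((tau n)%:E * F <= O + (tau n)%:E)%E.
Proof.
rewrite -[X in (_ <= _ + X)%E]intP -ge0_integralD//; last by move=> w _; rewrite lee_fin.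
rewrite -ge0_integralZl//; last by rewrite lee_fin.
apply: ge0_le_integral => //.
- by move=> w _; rewrite -EFinM lee_fin mulr_ge0.
- exact: emeasurable_funM.
- exact: emeasurable_funD.
- by move=> w _; rewrite -EFinM; apply: timer_storage_ge => // r; exact: hT.
Qed.

Let idle h t : \bar R := (~~ stored pi h t n)%:R%:E.

Let measurable_idle : measurable_process idle.
Proof.
rewrite (_ : idle = (fun h t => (if stored pi h t n then cst 0 (elapsed pi h t n)
                                 else cst 1 (elapsed pi h t n))%:E)).
  exact: measurable_stored_process.
by apply/funext => h; apply/funext => t; rewrite /idle; case: stored.
Qed.

Let idle_ge0 h t : (0 <= idle h t)%E. Proof. by rewrite lee_fin. Qed.

Let storage_idle w : (item_storage pi n T (requests X Y T w) +
  \int[leb]_(t in `[0%R, T]) idle (requests X Y T w) t = T%:E)%E.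
Proof.
rewrite /item_storage -ge0_integralD//.
- rewrite -[T in RHS]mul1r -integral_cst_horizon//.
  by apply: eq_integral => t _; rewrite -EFinD -natrD; case: stored.
- exact: measurable_funTS (measurable_process_section (measurable_storage_process mpi n) (hP w)).
- exact: measurable_funTS (measurable_process_section measurable_idle (hP w)).
Qed.

(** The fetches are the requests that find no copy: this is the formula for sums
    over requests, applied to the indicator of the times without a copy. *)
Let fetch_balance : (F + rate%:E * O = (rate * T)%:E)%E.
Proof.
have -> : (F = rate%:E * \int[P]_w
    \int[leb]_(t in `[0%R, T]) idle (requests X Y T w) t)%E.
  rewrite -(expected_sum_over_requests beta_gt0 p_gt0 XY_poisson n T measurable_idle)//.
    by apply: eq_integral => w _; rewrite timer_nfetch_requests// sumEFin.
  by move=> h t; rewrite /idle [in LHS](predictable_stored pi n h t).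
have mI := measurable_requests_functional XY_poisson T
  (measurable_functional_integral `[0, T] measurable_idle idle_ge0).
have I0 w : (0 <= \int[leb]_(t in `[0%R, T]) idle (requests X Y T w) t)%E.
  by apply: integral_ge0 => t _.
rewrite -ge0_muleDr; [|exact: integral_ge0|exact: integral_ge0].
rewrite -ge0_integralD// [in RHS]EFinM; congr (_ * _)%E.
rewrite -intP; apply: eq_integral => w _.
by rewrite addeC storage_idle.
Qed.

Let F_fin : F \is a fin_num.
Proof.
rewrite ge0_fin_numE; last by apply: integral_ge0 => w _; rewrite lee_fin.
apply: (@le_lt_trans _ _ (rate * T)%:E); last exact: ltry.
rewrite -fetch_balance leeDl// mule_ge0 ?lee_fin ?(ltW rate_gt0)//.
exact: integral_ge0.
Qed.

Let O_fin : O \is a fin_num.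
Proof.
rewrite ge0_fin_numE; last exact: integral_ge0.
apply: (le_lt_trans storage_le).
by rewrite -(fineK F_fin) -EFinM ltry.
Qed.

Let denominator_gt0 : 0 < rate * tau n + 1.
Proof. by rewrite ltr_wpDl// mulr_ge0// ltW. Qed.

(** By [fetch_balance] the fetches are rate * (T - O), and each one buys at most
    [tau n] of storage. *)
Lemma expected_timer_storage :
  (\int[P]_w item_storage pi n T (requests X Y T w) <=
   (T * (rate * tau n / (rate * tau n + 1)))%:E)%E.
Proof.
rewrite -/O; have := fetch_balance; have := storage_le.
rewrite -(fineK F_fin) -(fineK O_fin) -!EFinM -EFinD !lee_fin.
set f := fine F; set o := fine O => o_le [balance].
rewrite !mulrA ler_pdivlMr//.
have : rate * o <= rate * (tau n * f) by rewrite ler_pM2l.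
nra.
Qed.

Let expected_fetches :
  (F <= (rate * (T + tau n) / (rate * tau n + 1))%:E)%E.
Proof.
have := fetch_balance; have := storage_ge.
rewrite -(fineK F_fin) -(fineK O_fin) -!EFinM -!EFinD !lee_fin.
set f := fine F; set o := fine O => o_le [balance].
rewrite ler_pdivlMr//.
have : rate * (tau n * f) <= rate * (o + tau n) by rewrite ler_pM2l.
nra.
Qed.

(** The aging cost is again a sum over requests, of the age of the copy. Its
    integral over a storage period is at most [aging * tau n ^+ 2 / 2], so that it
    is paid as if every fetch cost [rate * aging * tau n ^+ 2 / 2] more. *)
Lemma expected_timer_cost fee aging : 0 <= fee -> 0 <= aging ->
  (\int[P]_w item_cost pi n fee aging T (requests X Y T w) <=
   ((fee + rate * aging * tau n ^+ 2 / 2) *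
    (rate * (T + tau n) / (rate * tau n + 1)))%:E)%E.
Proof.
move=> fee0 aging0.
pose g (x : R) := aging * Num.max x 0.
have g0 x : 0 <= g x by rewrite mulr_ge0// le_max lexx orbT.
have mg : measurable_fun setT g.
  by apply: measurable_funM => //; exact: measurable_maxr.
have int_g : (\int[leb]_(x in `[0%R, tau n]) (g x)%:E =
    (aging * tau n ^+ 2 / 2)%:E)%E.
  transitivity (\int[leb]_(x in `[0%R, tau n]) (0 + aging * x)%:E)%E.
    apply: eq_integral => x /set_mem /=; rewrite in_itv/= => /andP[x0 _].
    by rewrite /g max_l// add0r.
  by rewrite integral_affine// mul0r add0r.
pose age h t : \bar R :=
  (if stored pi h t n then g (elapsed pi h t n) else cst 0 (elapsed pi h t n))%:E.
have mage : measurable_process age by exact: measurable_stored_process.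
have age0 h t : (0 <= age h t)%E by rewrite lee_fin; case: ifP.
have costE w : item_cost pi n fee aging T (requests X Y T w) =
    (fee%:E * (nb_fetches w)%:R%:E +
     \sum_(r <- requests X Y T w | r.2 == n) age (requests X Y T w) r.1)%E.
  rewrite timer_item_cost//; last exact: hT.
  congr (_ + _)%E; apply: eq_bigr => r _; rewrite /age; case: ifP => // st.
  by rewrite /g max_l// elapsed_ge0// ltW// (stored_gt0 st).
have mage_sum := measurable_requests_functional XY_poisson T
  (measurable_functional_sum n mage).
have mage_int := measurable_requests_functional XY_poisson T
  (measurable_functional_integral `[0, T] mage age0).
under eq_integral do rewrite costE.
rewrite ge0_integralD//; first last.
- by move=> w _; exact: sume_ge0.
- exact: emeasurable_funM.
- by move=> w _; rewrite mule_ge0.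
rewrite ge0_integralZl//.
rewrite (expected_sum_over_requests beta_gt0 p_gt0 XY_poisson n T mage)//; last first.
  by move=> h t; rewrite /age [in LHS](predictable_stored pi n h t)
    [in LHS](predictable_elapsed pi n h t).
have age_le : (\int[P]_w \int[leb]_(t in `[0%R, T]) age (requests X Y T w) t <=
    (aging * tau n ^+ 2 / 2)%:E * F)%E.
  have c0 : 0 <= aging * tau n ^+ 2 / 2 by rewrite !mulr_ge0.
  rewrite -ge0_integralZl//.
  apply: ge0_le_integral => //.
  - by move=> w _; exact: integral_ge0.
  - exact: emeasurable_funM.
  - by move=> w _; rewrite -EFinM; apply: integral_timer_stored_le.
apply: (@le_trans _ _ ((fee + rate * aging * tau n ^+ 2 / 2)%:E * F)%E).
  rewrite EFinD ge0_muleDl ?lee_fin//; last by rewrite !mulr_ge0// ltW.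
  apply: leeD => //.
  rewrite (_ : rate * aging * tau n ^+ 2 / 2 = rate * (aging * tau n ^+ 2 / 2)).
    by rewrite [in leRHS]EFinM -muleA lee_pmul2l// lte_fin.
  by rewrite !mulrA.
rewrite [leRHS]EFinM; apply: lee_wpmul2l; last exact: expected_fetches.
by rewrite lee_fin addr_ge0// !mulr_ge0// ltW.
Qed.

End ExpectedTimer.

(** * The optimal timers and the price of storage *)

Section TauStar.
Context (R : realType) (N : nat).
Variables (beta cf ca : R) (b p lam : 'I_N -> R).
Hypotheses (beta_gt0 : 0 < beta) (cf_gt0 : 0 < cf) (ca_gt0 : 0 < ca)
  (b_gt0 : forall n, 0 < b n) (p_gt0 : forall n, 0 < p n)
  (lam_gt0 : forall n, 0 < lam n).
Local Notation rate n := (beta * p n).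
Local Notation aging n := (ca * lam n).
Local Notation tau := (tau_star beta cf ca b p lam).

Let rate_gt0 n : 0 < rate n. Proof. exact: mulr_gt0. Qed.
Let aging_gt0 n : 0 < aging n. Proof. exact: mulr_gt0. Qed.

Lemma tau_star_ge0 alpha n : 0 <= tau alpha n.
Proof. by rewrite mulr_ge0 ?invr_ge0 ?(ltW (rate_gt0 n))// le_max lexx orbT. Qed.

Lemma tau_star_eq0 alpha n : rate n * cf <= alpha -> tau alpha n = 0.
Proof.
move=> le_alpha; rewrite /tau_star max_r ?mulr0// subr_le0.
rewrite -[leRHS]sqrtr1 ler_wsqrtr// gerDl mulr_ge0_le0//.
  by rewrite mulr_ge0// ltW.
by rewrite mulr_le0_ge0 ?subr_le0// invr_ge0 ltW.
Qed.

(** In its simplest form, [rate n * tau alpha n] is the nonnegative root of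
    [x + x ^+ 2 / 2 = b n * (rate n * cf - alpha) / aging n], or 0 if there is
    none. *)
Lemma tau_starP alpha n :
  (tau alpha n = 0 /\ rate n * cf <= alpha) \/
  aging n * (rate n * tau alpha n + (rate n * tau alpha n) ^+ 2 / 2) =
    b n * (rate n * cf - alpha).
Proof.
have [le_alpha|gt_alpha] := leP (rate n * cf) alpha.
  by left; rewrite tau_star_eq0.
right; set v := (rate n * cf - alpha) / (aging n).
have v0 : 0 < v by rewrite divr_gt0// subr_gt0.
have bv0 : 0 < 2 * b n * v by rewrite mulr_gt0// mulr_gt0.
have -> : rate n * tau alpha n = Num.sqrt (1 + 2 * b n * v) - 1.
  rewrite /tau_star mulVKf ?gt_eqF// max_l// subr_ge0.
  by rewrite -[leLHS]sqrtr1 ler_wsqrtr// lerDl ltW.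
have sq : Num.sqrt (1 + 2 * b n * v) ^+ 2 = 1 + 2 * b n * v.
  by rewrite sqr_sqrtr// addr_ge0// ltW.
have -> : b n * (rate n * cf - alpha) = b n * aging n * v.
  by rewrite /v; field; rewrite !gt_eqF.
move: sq; set x := Num.sqrt _ => sq.
have -> : x - 1 + (x - 1) ^+ 2 / 2 = (x ^+ 2 - 1) / 2 by field.
by rewrite sq; field.
Qed.

(** With the next lemma, these are the two inequalities on which the lower bound
    for the cost of an item rests. *)
Lemma tau_star_gain_ge alpha n : 0 <= alpha ->
  aging n * tau alpha n <= b n * cf - rate n * aging n * tau alpha n ^+ 2 / 2.
Proof.
move=> alpha0; have [[-> _]|E] := tau_starP alpha n.
  by rewrite mulr0 expr0n/= mulr0 mul0r subr0 mulr_ge0// ltW.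
rewrite -(ler_pM2l (rate_gt0 n)) -subr_ge0.
apply: (@le_trans _ _ (b n * alpha)); first by rewrite mulr_ge0// ltW.
rewrite le_eqVlt; apply/orP; left; apply/eqP.
have -> : b n * alpha = b n * rate n * cf - b n * (rate n * cf - alpha) by ring.
by rewrite -E; field.
Qed.

Lemma tau_star_gain_le alpha n :
  rate n * (b n * cf - rate n * aging n * tau alpha n ^+ 2 / 2) <=
  alpha * b n + rate n * aging n * tau alpha n.
Proof.
have [[-> le_alpha]|E] := tau_starP alpha n.
  rewrite expr0n/= !mulr0 mul0r subr0 addr0.
  by rewrite mulrCA mulrC ler_pM2r.
rewrite le_eqVlt; apply/orP; left; apply/eqP.
have -> : alpha * b n = b n * rate n * cf - b n * (rate n * cf - alpha) by ring.
by rewrite -E; field.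
Qed.

(** The timer policy attains the lower bound: item by item, its long-term cost
    plus the price alpha of its storage is the gain rate. *)
Lemma tau_star_balance alpha n :
  (b n * cf + rate n * aging n * tau alpha n ^+ 2 / 2) *
    (rate n / (rate n * tau alpha n + 1)) =
  rate n * (b n * cf - rate n * aging n * tau alpha n ^+ 2 / 2)
  - alpha * (rate n * tau alpha n / (rate n * tau alpha n + 1) * b n).
Proof.
have [[-> le_alpha]|E] := tau_starP alpha n.
  by rewrite expr0n/= !(mulr0, mul0r, addr0, subr0, add0r) divr1 mulrC.
have D : rate n * tau alpha n + 1 != 0.
  by rewrite gt_eqF// ltr_wpDl// mulr_ge0 ?tau_star_ge0// ltW.
(* The difference of the two sides is a multiple of the equation for tau. *)
apply/eqP; rewrite -subr_eq0; apply/eqP.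
transitivity (rate n * tau alpha n / (rate n * tau alpha n + 1) *
  (aging n * (rate n * tau alpha n + (rate n * tau alpha n) ^+ 2 / 2)
   - b n * (rate n * cf - alpha))); last by rewrite E subrr mulr0.
by field.
Qed.

Let continuous_occupancy :
  continuous (fun alpha => timer_occupancy beta b p (tau alpha)).
Proof.
apply: continuous_big => [|n _].
  by move=> x; exact: add_continuous.
have tau_cont : continuous (fun alpha => tau alpha n : R).
  move=> alpha; apply: cvgM; first exact: cvg_cst.
  apply: (@continuous_max R R _ _ alpha); last exact: cvg_cst.
  apply: cvgB; last exact: cvg_cst.
  apply: continuous_cvg; first exact: sqrt_continuous.
  apply: cvgD; first exact: cvg_cst.
  apply: cvgM; first exact: cvg_cst.
  apply: cvgM; last exact: cvg_cst.
  by apply: cvgB; [exact: cvg_cst|exact: cvg_id].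
move=> alpha; apply: cvgM; last exact: cvg_cst.
have rt : (beta * p n * tau x n @[x --> alpha] --> beta * p n * tau alpha n).
  by apply: cvgM; [exact: cvg_cst|exact: tau_cont].
apply: cvgM => //; apply: cvgV.
  by rewrite gt_eqF// ltr_wpDl// mulr_ge0 ?tau_star_ge0// ltW.
by apply: cvgD => //; exact: cvg_cst.
Qed.

(** The occupancy is a continuous function of alpha, which vanishes at beta * cf:
    either the constraint holds at price 0, or some price saturates the constraint. *)
Lemma exists_complementary_slackness (B : R) :
  \sum_(n < N) p n = 1 -> 0 <= B ->
  exists2 alpha, 0 <= alpha & complementary_slackness beta cf ca b p lam B alpha.
Proof.
move=> p1 B0; pose S alpha := timer_occupancy beta b p (tau alpha).
have [S0B|BS0] := leP (S 0) B.
  by exists 0 => //; split; rewrite ?mul0r.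
(* At this price no item is worth storing, since p n <= 1. *)
have Sbeta : S (beta * cf) = 0.
  rewrite /S /timer_occupancy big1// => n _.
  rewrite tau_star_eq0 ?mulr0 ?mul0r//.
  rewrite ler_wpM2r ?(ltW cf_gt0)// ger_pMr// -p1 (bigD1 n)//= lerDl.
  by apply: sumr_ge0 => m _; exact: ltW.
have [|||alpha] := @IVT R S 0 (beta * cf) B.
- by rewrite mulr_ge0// ltW.
- exact/continuous_subspaceT/continuous_occupancy.
- by rewrite Sbeta ge_min B0 orbT le_max (ltW BS0).
rewrite in_itv/= => /andP[alpha0 _] SB; exists alpha => //.
by rewrite /complementary_slackness -/(S alpha) SB subrr mulr0.
Qed.

End TauStar.

(** * Long-term averages *)

Section LongTermAverage.
Context (R : realType).
Implicit Types (f g : R -> \bar R).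

Lemma long_term_average_le f (c k : R) : 0 <= k ->
  (forall T, 0 < T -> (f T <= (c * T + k)%:E)%E) ->
  (long_term_average f <= c%:E)%E.
Proof.
move=> k0 fle; apply/lee_addgt0Pr => e e0.
rewrite /long_term_average limf_esupE; apply: (@le_trans _ _
  (ereal_sup [set ((T^-1)%:E * f T)%E | T in [set T | Num.max 0 (k / e) < T]])).
  apply: ereal_inf_lbound; exists [set T | Num.max 0 (k / e) < T] => //.
  by exists (Num.max 0 (k / e)); split => //; exact: num_real.
apply: ge_ereal_sup => _ [T /= + <-]; rewrite gt_max => /andP[T0 kT].
apply: (@le_trans _ _ ((T^-1)%:E * (c * T + k)%:E)%E).
  by apply: lee_wpmul2l; [rewrite lee_fin invr_ge0 ltW|exact: fle].
rewrite -EFinM -EFinD lee_fin mulrC ler_pdivrMr// mulrDl lerD2l mulrC.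
by rewrite -ler_pdivrMr// ltW.
Qed.

(** The passage to the limit of the Lagrangian lower bound: averages are taken
    along times at which the occupancy is close to its limit superior. *)
Lemma long_term_average_ge f g (c alpha B : R) : 0 <= alpha ->
  (forall T, 0 < T -> ((T * c)%:E <= f T + alpha%:E * g T)%E) ->
  (forall T, 0 < T -> (0 <= g T)%E) ->
  (long_term_average g <= B%:E)%E ->
  ((c - alpha * B)%:E <= long_term_average f)%E.
Proof.
move=> alpha0 fg g0 gB; rewrite /long_term_average limf_esupE.
apply: le_ereal_inf_tmp => _ [V Voo <-]; apply/lee_addgt0Pr => e e0.
(* This choice gives alpha * e' <= e, including for alpha = 0. *)
pose e' := e / (alpha + 1).
have alpha1 : 0 < alpha + 1 by rewrite ltr_wpDl.
have e'0 : 0 < e' by rewrite divr_gt0.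
have : (long_term_average g < (B + e')%:E)%E.
  by apply: le_lt_trans gB _; rewrite lte_fin ltrDl.
rewrite /long_term_average limf_esupE => /ereal_inf_lt[_ [W Woo <-]] gW.
have [T [[VT WT] T0]] : exists T, (V `&` W) T /\ 0 < T.
  have [M [_ MV]] : pinfty_nbhs R (V `&` W `&` [set T | 0 < T]).
    apply: filterI; first exact: filterI.
    by exists 0; split => //; exact: num_real.
  by have [|VW T0] := MV (M + 1); [rewrite ltrDl|exists (M + 1)].
have T'0 : (0 <= (T^-1)%:E)%E by rewrite lee_fin invr_ge0 ltW.
have gT : ((T^-1)%:E * g T <= (B + e')%:E)%E.
  by apply: le_trans (ltW gW); apply: ereal_sup_ubound; exists T.
have fT : ((T^-1)%:E * f T <= ereal_sup [set (T^-1)%:E * f T | T in V])%E.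
  by apply: ereal_sup_ubound; exists T.
apply: (@le_trans _ _ ((T^-1)%:E * f T + e%:E)%E); last exact: leeD.
have gT_fin : g T \is a fin_num.
  rewrite ge0_fin_numE ?g0// ltNge leye_eq; apply/negP => /eqP gTy.
  by move: gT; rewrite gTy gt0_muley ?lte_fin ?invr_gt0// leye_eq.
move: gT (fg _ T0); rewrite -(fineK gT_fin); set y := fine _.
case: (f T) => [x| |].
- rewrite -!EFinM -!EFinD !lee_fin => gT cT.
  have : T^-1 * (T * c) <= T^-1 * (x + alpha * y) by rewrite ler_pM2l ?invr_gt0.
  rewrite mulKf ?gt_eqF// mulrDr (mulrCA _ alpha) => le_c.
  have : alpha * (T^-1 * y) <= alpha * (B + e') by rewrite ler_wpM2l.
  have : alpha * e' <= e.
    by rewrite /e' mulrA ler_pdivrMr// mulrDr mulr1 [leLHS]mulrC lerDl ltW.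
  lra.
- by move=> _ _; rewrite gt0_muley ?lte_fin ?invr_gt0// addye// leey.
- by [].
Qed.

End LongTermAverage.

Section ItemDecomposition.
Context (R : realType) (N : nat).
Variables (cf ca : R) (b lam : 'I_N -> R) (pi : policy R N).
Implicit Types (h : history R N).
Local Notation leb := (@lebesgue_measure R).

Lemma total_cost_items T h : total_cost cf ca b lam pi T h =
  (\sum_(n < N) item_cost pi n (b n * cf) (ca * lam n) T h)%E.
Proof.
rewrite /total_cost /item_cost big_split/=; congr (_ + _)%E.
under [RHS]eq_bigr do rewrite sumEFin.
rewrite sumEFin; congr EFin.
rewrite (exchange_big_dep xpredT)//=; apply: eq_bigr => -[t m] _ /=.
by under [RHS]eq_bigl do rewrite eq_sym; rewrite big_pred1_eq.
Qed.

Lemma total_occupancy_items T h : (forall n, 0 <= b n) ->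
  measurable_policy pi -> possible_history h ->
  total_occupancy b pi T h = (\sum_(n < N) (b n)%:E * item_storage pi n T h)%E.
Proof.
move=> b0 mpi hP; rewrite /total_occupancy.
have mst n := measurable_process_section (measurable_storage_process mpi n) hP.
have mbst n : measurable_fun setT (fun t => (b n)%:E * (stored pi h t n)%:R%:E)%E.
  exact: emeasurable_funM.
transitivity (\int[leb]_(t in `[0%R, T])
    \sum_(n < N) (b n)%:E * (stored pi h t n)%:R%:E)%E.
  by apply: eq_integral => t _; rewrite -sumEFin.
rewrite ge0_integral_sum//; first last.
- by move=> n t _; rewrite mule_ge0// lee_fin.
- by move=> n; exact: measurable_funTS (mbst n).
apply: eq_bigr => n _; rewrite ge0_integralZl//; last by rewrite lee_fin.
exact: measurable_funTS (mst n).
Qed.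

End ItemDecomposition.

Section ExpectedItems.
Context (R : realType) (N : nat) (d : measure_display) (Omega : measurableType d)
  (P : probability Omega R).
Variables (X : nat -> {RV P >-> R}) (Y : nat -> Omega -> 'I_N).
Variables (beta : R) (p : 'I_N -> R).
Hypothesis (XY_poisson : poisson_requests beta p X Y).
Variables (cf ca : R) (b lam : 'I_N -> R) (pi : policy R N) (T : R).
Hypothesis mpi : measurable_policy pi.

Lemma expected_total_cost : (forall n, 0 <= b n * cf) -> (forall n, 0 <= ca * lam n) ->
  (\int[P]_w total_cost cf ca b lam pi T (requests X Y T w) =
   \sum_(n < N) \int[P]_w item_cost pi n (b n * cf) (ca * lam n) T (requests X Y T w))%E.
Proof.
move=> fee0 aging0; under eq_integral do rewrite total_cost_items.
have mcost n := measurable_requests_functional XY_poisson T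
  (measurable_item_cost mpi n (b n * cf) (ca * lam n) T).
rewrite ge0_integral_sum//.
by move=> n w _; apply: item_cost_ge0 => //; exact: possible_requests.
Qed.

Lemma expected_total_occupancy : (forall n, 0 <= b n) ->
  (\int[P]_w total_occupancy b pi T (requests X Y T w) =
   \sum_(n < N) (b n)%:E * \int[P]_w item_storage pi n T (requests X Y T w))%E.
Proof.
move=> b0; have mst n := measurable_requests_functional XY_poisson T
  (measurable_item_storage mpi n T).
transitivity (\int[P]_w \sum_(n < N)
    (b n)%:E * item_storage pi n T (requests X Y T w))%E.
  by apply: eq_integral => w _; apply: total_occupancy_items => //; exact: possible_requests.
rewrite ge0_integral_sum//; first last.
- by move=> n w _; rewrite mule_ge0 ?lee_fin// item_storage_ge0.
- by move=> n; exact: emeasurable_funM.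
apply: eq_bigr => n _; rewrite ge0_integralZl// ?lee_fin// => w _.
exact: item_storage_ge0.
Qed.

End ExpectedItems.

(** * Optimality of the timer policy *)

Theorem theorem1 (R : realType) (N : nat) (beta cf ca : R)
    (b p lam : 'I_N -> R) (B : R)
    (d : measure_display) (Omega : measurableType d) (P : probability Omega R)
    (X : nat -> {RV P >-> R}) (Y : nat -> Omega -> 'I_N)
    (beta_gt0 : 0 < beta) (cf_gt0 : 0 < cf) (ca_gt0 : 0 < ca)
    (b_gt0 : forall n, 0 < b n) (p_gt0 : forall n, 0 < p n)
    (p_sum1 : \sum_(n < N) p n = 1) (lam_gt0 : forall n, 0 < lam n)
    (B_ge0 : 0 <= B) (XY_poisson : poisson_requests beta p X Y) :
  (exists alpha : R,
     0 <= alpha /\ complementary_slackness beta cf ca b p lam B alpha) /\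
  (forall alpha : R,
     0 <= alpha -> complementary_slackness beta cf ca b p lam B alpha ->
     optimal X Y cf ca b lam B
       (timer_policy (tau_star beta cf ca b p lam alpha))).
Proof.
split.
  have [alpha alpha0 cs] := exists_complementary_slackness beta_gt0 cf_gt0 ca_gt0
    b_gt0 p_gt0 lam_gt0 p_sum1 B_ge0.
  by exists alpha.
move=> alpha alpha0; rewrite /complementary_slackness.
set tau := tau_star beta cf ca b p lam alpha.
set S := timer_occupancy beta b p tau => -[S_le slack].
have tau0 n : 0 <= tau n by exact: tau_star_ge0.
have rate_gt0 n : 0 < beta * p n by exact: mulr_gt0.
have fee_gt0 n : 0 < b n * cf by exact: mulr_gt0.
have aging_gt0 n : 0 < ca * lam n by exact: mulr_gt0.
have b0 n : 0 <= b n by exact: ltW.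
have fee0 n : 0 <= b n * cf by exact: ltW.
have aging0 n : 0 <= ca * lam n by exact: ltW.
pose gain n := b n * cf - beta * p n * (ca * lam n) * tau n ^+ 2 / 2.
pose G := \sum_(n < N) beta * p n * gain n.
have timer_adm := timer_policy_admissible tau0.
split; first exact: timer_adm.
  apply: (@le_trans _ _ S%:E); last by rewrite lee_fin.
  apply: (long_term_average_le (lexx 0)) => T T0.
  rewrite (expected_total_occupancy XY_poisson _ timer_adm.1)//.
  apply: (@le_trans _ _ (\sum_(n < N) (b n)%:E *
    (T * (beta * p n * tau n / (beta * p n * tau n + 1)))%:E)%E).
    apply: lee_sum => n _; apply: lee_wpmul2l; first by rewrite lee_fin.
    by apply: (expected_timer_storage beta_gt0 p_gt0 XY_poisson tau0); exact: ltW.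
  rewrite sumEFin lee_fin addr0 mulr_suml le_eqVlt; apply/orP; left; apply/eqP.
  by apply: eq_bigr => n _; ring.
(* G - alpha * B is the value of the relaxed problem: it bounds the cost of
   every competitor, and the timers attain it. *)
move=> pi' pi'_adm occ_le; apply: (@le_trans _ _ (G - alpha * B)%:E); last first.
  apply: (long_term_average_ge alpha0 _ _ occ_le) => T T0; last first.
    apply: integral_ge0 => w _; apply: integral_ge0 => t _.
    by rewrite lee_fin sumr_ge0// => n _; rewrite mulr_ge0.
  rewrite (expected_total_cost XY_poisson _ pi'_adm.1)//.
  rewrite (expected_total_occupancy XY_poisson _ pi'_adm.1)//.
  rewrite ge0_sume_distrr; last first.
    move=> n _; rewrite mule_ge0 ?lee_fin//.
    by apply: integral_ge0 => w _; exact: item_storage_ge0.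
  rewrite -big_split/= mulr_sumr -sumEFin; apply: lee_sum => n _.
  rewrite muleA -EFinM.
  apply: (expected_cost_lower_bound beta_gt0 p_gt0 XY_poisson pi'_adm (tau := tau n)) => //.
  - exact: mulr_ge0.
  - exact: tau_star_gain_ge.
  - exact: tau_star_gain_le.
  - by rewrite /gain subrK.
  - exact: ltW.
pose w n := b n * cf + beta * p n * (ca * lam n) * tau n ^+ 2 / 2.
have w0 n : 0 <= w n by rewrite addr_ge0// divr_ge0// mulr_ge0 ?sqr_ge0// mulr_ge0// ltW.
(* k bounds the overhead of the storage periods cut by the horizon. *)
pose k := \sum_(n < N) w n * (beta * p n * tau n / (beta * p n * tau n + 1)).
have k0 : 0 <= k.
  apply: sumr_ge0 => n _; rewrite mulr_ge0// divr_ge0 ?addr_ge0//.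
    by rewrite mulr_ge0// ltW.
  by rewrite mulr_ge0// ltW.
apply: (long_term_average_le k0) => T T0.
rewrite (expected_total_cost XY_poisson _ timer_adm.1)//.
apply: (@le_trans _ _ (\sum_(n < N)
  (w n * (beta * p n * (T + tau n) / (beta * p n * tau n + 1)))%:E)%E).
  apply: lee_sum => n _.
  by apply: (expected_timer_cost beta_gt0 p_gt0 XY_poisson tau0) => //; exact: ltW.
have -> : G - alpha * B = \sum_(n < N) w n * (beta * p n / (beta * p n * tau n + 1)).
  under eq_bigr do rewrite tau_star_balance//.
  rewrite sumrB -mulr_sumr -/S; congr (_ - _).
  by apply/esym/eqP; rewrite -subr_eq0 -mulrBr; apply/eqP.
rewrite sumEFin lee_fin mulr_suml -big_split/= le_eqVlt; apply/orP; left; apply/eqP.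
by apply: eq_bigr => n _; ring.
Qed.
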